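(* Given 1-marginals $(u_{i,+,+})$, $(u_{+,j,+})$, $(u_{+,+,k})$ and entry upper bounds $(p_{i,j,k})$ for 3-tables of size $(r,c,h)$, there exist polynomial time constructible 2-marginals $(v_{i,j,+})$, $(v_{i,+,k})$, $(v_{+,j,k})$ for 3-tables of size $(3,\,rc,\,r+c+h)$ such that the set of nonnegative real $(r,c,h)$-arrays $x$ satisfying the given upper bounds $x_{i,j,k}\le p_{i,j,k}$ (for all $i,j,k$) and having the given 1-marginals is in integer preserving affine bijection with the set of nonnegative real $(3,\,rc,\,r+c+h)$-arrays having the constructed 2-marginals.
   Context: A real $(n_1,n_2,n_3)$-array is an array $x=(x_{i,j,k})$ of real numbers, $1\le i\le n_1$, $1\le j\le n_2$, $1\le k\le n_3$; a 3-table of size $(n_1,n_2,n_3)$ is such an array with nonnegative integer entries. Replacing an index by $+$ denotes summation over that index. The 1-marginals of $x$ are the vectors $(x_{i,+,+})=(\sum_{j,k}x_{i,j,k})$, $(x_{+,j,+})=(\sum_{i,k}x_{i,j,k})$, $(x_{+,+,k})=(\sum_{i,j}x_{i,j,k})$. The 2-marginals of $x$ are the arrays $(x_{i,j,+})=(\sum_k x_{i,j,k})$, $(x_{i,+,k})=(\sum_j x_{i,j,k})$, $(x_{+,j,k})=(\sum_i x_{i,j,k})$. The given 1-marginals are three vectors of integers $(u_{i,+,+})_{1\le i\le r}$, $(u_{+,j,+})_{1\le j\le c}$, $(u_{+,+,k})_{1\le k\le h}$, all nonnegative, and the given entry upper bounds $p_{i,j,k}$ are nonnegative integers. The constructed 2-marginals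 are integer arrays. ''Polynomial time constructible'' means that there is an algorithm which, from $r,c,h$, the $u$'s and the $p$'s, computes the 2-marginals $v$ in time polynomial in the size of the input. An integer preserving affine bijection between two sets of real arrays is a bijection that is the restriction of an affine map and under which an array is integer-valued if and only if its image is integer-valued (so that it restricts to a bijection between the sets of 3-tables contained in the two sets). *)

(* Defs.v *)
From HB Require Import structures.
From mathcomp Require Import all_boot all_order all_algebra.
From mathcomp Require Import all_classical all_reals.

Set Implicit Arguments.
Unset Strict Implicit.
Unset Printing Implicit Defensive.

Import Order.TTheory GRing.Theory Num.Theory.
Local Open Scope ring_scope.

(** * Arrays and marginals *)

Notation array1 T n := {ffun 'I_n -> T}.
Notation array2 T n1 n2 := {ffun 'I_n1 * 'I_n2 -> T}.
Notation array3 T n1 n2 n3 := {ffun 'I_n1 * 'I_n2 * 'I_n3 -> T}.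

(** [R^o] is [R] seen as a module over itself, so that real arrays form an
    [lmodType R]. *)
Notation real_array R n1 n2 n3 := (array3 R^o n1 n2 n3).

Record marginals1 (T : Type) (n1 n2 n3 : nat) := Marginals1 {
  m1_i : array1 T n1;
  m1_j : array1 T n2;
  m1_k : array1 T n3 }.

Record marginals2 (T : Type) (n1 n2 n3 : nat) := Marginals2 {
  m2_ij : array2 T n1 n2;
  m2_ik : array2 T n1 n3;
  m2_jk : array2 T n2 n3 }.

Definition has_1marginals (R : realType) (n1 n2 n3 : nat)
    (u : marginals1 nat n1 n2 n3) (x : real_array R n1 n2 n3) : Prop :=
  [/\ forall i, \sum_j \sum_k (x (i, j, k) : R) = (m1_i u i)%:R,
      forall j, \sum_i \sum_k (x (i, j, k) : R) = (m1_j u j)%:R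
    & forall k, \sum_i \sum_j (x (i, j, k) : R) = (m1_k u k)%:R].

Definition has_2marginals (R : realType) (n1 n2 n3 : nat)
    (v : marginals2 int n1 n2 n3) (y : real_array R n1 n2 n3) : Prop :=
  [/\ forall i j, \sum_k (y (i, j, k) : R) = (m2_ij v (i, j))%:~R,
      forall i k, \sum_j (y (i, j, k) : R) = (m2_ik v (i, k))%:~R
    & forall j k, \sum_i (y (i, j, k) : R) = (m2_jk v (j, k))%:~R].

Definition nonneg_array (R : realType) (n1 n2 n3 : nat)
    (x : real_array R n1 n2 n3) : Prop :=
  forall i j k, 0 <= (x (i, j, k) : R).

Definition integer_array (R : realType) (n1 n2 n3 : nat)
    (x : real_array R n1 n2 n3) : Prop :=
  forall i j k, (x (i, j, k) : R) \is a Num.int.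

(** The given data: a size, 1-marginals and entry upper bounds. *)
Record bounded_data := BoundedData {
  bd_r : nat;
  bd_c : nat;
  bd_h : nat;
  bd_u : marginals1 nat bd_r bd_c bd_h;
  bd_p : array3 nat bd_r bd_c bd_h }.

Definition bounded_arrays (R : realType) (D : bounded_data) :
    set (real_array R (bd_r D) (bd_c D) (bd_h D)) :=
  [set x | [/\ nonneg_array x,
               forall i j k, (x (i, j, k) : R) <= (bd_p D (i, j, k))%:R
             & has_1marginals (bd_u D) x]]%classic.

Definition arrays_with_2marginals (R : realType) (n1 n2 n3 : nat)
    (v : marginals2 int n1 n2 n3) : set (real_array R n1 n2 n3) :=
  [set y | nonneg_array y /\ has_2marginals v y]%classic.

(** * Integer preserving affine bijections *)

Definition affine_map (R : realType) (U V : lmodType R) (f : U -> V) : Prop :=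
  exists (L : {linear U -> V}) (b : V), forall x, f x = L x + b.

Definition integer_preserving_affine_bijective (R : realType)
    (n1 n2 n3 m1 m2 m3 : nat)
    (A : set (real_array R n1 n2 n3)) (B : set (real_array R m1 m2 m3)) : Prop :=
  exists f : real_array R n1 n2 n3 -> real_array R m1 m2 m3,
    [/\ affine_map f,
        set_bij A B f
      & forall x, A x -> (integer_array x <-> integer_array (f x))].

(** * Polynomial time *)

(** The model of computation is the random access machine of Cook and Reckhow
    under the logarithmic cost criterion, with structured control instead of
    jumps. Its memory is an infinite sequence of integer registers [X_0, X_1,
    ...], all initially 0; there is a read-once input tape and a write-only
    output tape, both holding integers. There is no multiplication. *)
Inductive ram :=
| RConst (i : nat) (z : int)    (* X_i := z *)
| RAdd (i j k : nat)            (* X_i := X_j + X_k *)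
| RSub (i j k : nat)            (* X_i := X_j - X_k *)
| RLoad (i j : nat)             (* X_i := X_(X_j) *)
| RStore (i j : nat)            (* X_(X_i) := X_j *)
| RRead (i : nat)
| RPrint (i : nat)
| RSeq (P Q : ram)
| RIfPos (i : nat) (P Q : ram)  (* if X_i > 0 then P else Q *)
| RWhilePos (i : nat) (P : ram) (* while X_i > 0 do P *).

Record ram_state := RamState {
  reg : nat -> int;
  intape : seq int;
  outtape : seq int }.

Definition set_reg (i : nat) (z : int) (s : ram_state) : ram_state :=
  RamState (fun j => if j == i then z else reg s j) (intape s) (outtape s).

(** Binary digits of [`|z|] (one digit for 0), plus a sign. *)
Definition bits (z : int) : nat := (trunc_log 2 `|z|%N).+2.

(** [ram_exec P s s' t]: started in state [s], the program [P] halts in state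
    [s'] after time [t]. Every elementary step costs the bit lengths of its
    operands, addresses of indirect accesses included. A program that uses a
    negative address or reads past the end of the input gets stuck. *)
Inductive ram_exec : ram -> ram_state -> ram_state -> nat -> Prop :=
| ExConst i z s : ram_exec (RConst i z) s (set_reg i z s) (bits z)
| ExAdd i j k s :
    ram_exec (RAdd i j k) s (set_reg i (reg s j + reg s k) s)
      (bits (reg s j) + bits (reg s k))%N
| ExSub i j k s :
    ram_exec (RSub i j k) s (set_reg i (reg s j - reg s k) s)
      (bits (reg s j) + bits (reg s k))%N
| ExLoad i j a s : reg s j = Posz a ->
    ram_exec (RLoad i j) s (set_reg i (reg s a) s)
      (bits (reg s j) + bits (reg s a))%N
| ExStore i j a s : reg s i = Posz a ->
    ram_exec (RStore i j) s (set_reg a (reg s j) s)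
      (bits (reg s i) + bits (reg s j))%N
| ExRead i z m inp out :
    ram_exec (RRead i) (RamState m (z :: inp) out)
      (set_reg i z (RamState m inp out)) (bits z)
| ExPrint i s :
    ram_exec (RPrint i) s
      (RamState (reg s) (intape s) (rcons (outtape s) (reg s i)))
      (bits (reg s i))
| ExSeq P Q s1 s2 s3 t1 t2 :
    ram_exec P s1 s2 t1 -> ram_exec Q s2 s3 t2 ->
    ram_exec (RSeq P Q) s1 s3 (t1 + t2)%N
| ExIfTrue i P Q s s' t : 0 < reg s i -> ram_exec P s s' t ->
    ram_exec (RIfPos i P Q) s s' (bits (reg s i) + t)%N
| ExIfFalse i P Q s s' t : reg s i <= 0 -> ram_exec Q s s' t ->
    ram_exec (RIfPos i P Q) s s' (bits (reg s i) + t)%N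
| ExWhileStop i P s : reg s i <= 0 ->
    ram_exec (RWhilePos i P) s s (bits (reg s i))
| ExWhileLoop i P s1 s2 s3 t1 t2 : 0 < reg s1 i ->
    ram_exec P s1 s2 t1 -> ram_exec (RWhilePos i P) s2 s3 t2 ->
    ram_exec (RWhilePos i P) s1 s3 (bits (reg s1 i) + t1 + t2)%N.

Definition ram_init (w : seq int) : ram_state := RamState (fun=> 0) w [::].

Definition input_size (w : seq int) : nat := (\sum_(z <- w) bits z)%N.

Definition polytime_computable (I : Type) (O : I -> Type)
    (encI : I -> seq int) (encO : forall D : I, O D -> seq int)
    (f : forall D : I, O D) : Prop :=
  exists (P : ram) (q : {poly nat}), forall D : I,
  exists (s : ram_state) (t : nat),
    [/\ ram_exec P (ram_init (encI D)) s t,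
        outtape s = encO D (f D)
      & (t <= q.[input_size (encI D)])%N].

(** [codom] lists the entries of an array in lexicographic order of the
    indices. *)
Definition encode_bounded_data (D : bounded_data) : seq int :=
  [:: Posz (bd_r D); Posz (bd_c D); Posz (bd_h D)] ++
  map Posz (codom (m1_i (bd_u D)) ++ codom (m1_j (bd_u D)) ++
            codom (m1_k (bd_u D)) ++ codom (bd_p D)).

Definition encode_marginals2 (n1 n2 n3 : nat) (v : marginals2 int n1 n2 n3) :
    seq int :=
  codom (m2_ij v) ++ codom (m2_ik v) ++ codom (m2_jk v).

Notation slim_marginals D :=
  (marginals2 int 3 (bd_r D * bd_c D)%N (bd_r D + bd_c D + bd_h D)%N).

(* Main.v *)
Require Import Defs.
From HB Require Import structures.
From mathcomp Require Import all_boot all_order all_algebra.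
From mathcomp Require Import all_classical all_reals.
From mathcomp Require Import zify ring lra.

Set Implicit Arguments.
Unset Strict Implicit.
Unset Printing Implicit Defensive.

Import Order.TTheory GRing.Theory Num.Theory.
Local Open Scope nat_scope.

(** Let [X_ij] be the sum of [x] over [k] and [P_ij] the sum of the upper bounds
    [p] over [k]. An [(r,c,h)]-array [x] is spread over three layers, in the row
    [(i,j)] and in the columns [i], [j] (the only nonzero ones among the first
    [r + c]) and [k]:
<<
                 column i      column j      column k
      layer 0    P_ij - X_ij   0             x_ijk
      layer 1    0             X_ij          p_ijk - x_ijk
      layer 2    X_ij          P_ij - X_ij   0
>>
    Columns [k] record [x] and its slack with respect to [p]; in columns [i]
    and [j] the same total [X_ij] is stored once more, in such a way that every
    layer of the row sums to [P_ij]. The sums over the layers are [p_ijk], and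
    [P_ij] in the columns [i] and [j]; the sums over the rows are the 1-marginals
    [u], their complements [P_i - u_i], [P_j - u_j], [P_k - u_k], and 0. None of
    these depends on [x], and they are the 2-marginals [slim]. Conversely, in a
    nonnegative array with these 2-marginals, every entry whose line sum is 0
    vanishes, and the remaining line sums force all entries to be as in the table
    for the array [x] read off from layer 0; the sums over the rows then say that
    [x] has the 1-marginals [u], and nonnegativity in layers 0 and 1 that
    [0 <= x <= p] ([first_layerK], [first_layer_bounded]). The table is affine in
    [x] and has integral coefficients ([slim_array_bijective]).

    That [slim] is computed in polynomial time takes three observations.
    - A machine that only adds and subtracts lengthens its numbers by at most one
      bit per step. Hence [n] steps, started with numbers below [2 ^ m], take time
      at most [n * 2 (m + n + 1)], and it is enough to count steps ([runs]).
    - All entries of [slim] are given by conditionals and finite sums with ranges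
      among [r], [c], [h], and are printed by nested loops over such ranges.
      Programs in a small language with these constructs are compiled to the
      machine ([wp_compile_expr], [wp_compile_cmd]); the number of steps of a
      compiled program is polynomial in the ranges because loops are bounded
      by them ([poly_bounded_cmd_cost]).
    - The ranges are bounded by the size of the input, which lists the vectors [u]
      in full ([polytime_slim]). *)

(** * Counting the steps of random access machine programs *)

Definition magnitude_lt (m : nat) (z : int) : bool := (`|z| < 2 ^ m).

(** The bound [8 <= m] leaves room for the constants in the programs, which are
    below [2 ^ 8], see [wp_const]. *)
Definition bounded_state (m : nat) (s : ram_state) : Prop :=
  [/\ (8 <= m), forall i, magnitude_lt m (reg s i)
    & all (magnitude_lt m) (intape s)].

(** [n] bounds a number of elementary steps, of unit cost. Each step doubles the
    largest magnitude at most, so that after [n] steps all numbers are below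
    [2 ^ (m + n)], and a step, which costs the length of at most two operands,
    costs at most [2 (m + n + 1)]. Since [m] is universally quantified, the
    lengths of numbers need not be tracked in program proofs. *)
Definition runs (P : ram) (s s' : ram_state) (n : nat) : Prop :=
  forall m, bounded_state m s ->
    bounded_state (m + n) s' /\
    exists2 t, ram_exec P s s' t & (t <= n * (m + n).+1.*2).

(** Total correctness within [n] steps. The postcondition comes before the state
    so that [wp Q n2 C] can serve as a postcondition, see [wp_seq]. *)
Definition wp (P : ram) (n : nat) (Q : ram_state -> Prop) (s : ram_state) :
    Prop :=
  exists2 s', runs P s s' n & Q s'.

Lemma magnitude_ltW m m' z :
  (m <= m') -> magnitude_lt m z -> magnitude_lt m' z.
Proof. by rewrite /magnitude_lt => le_m /leq_trans; apply; rewrite leq_exp2l. Qed.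

Lemma bounded_stateW m m' s :
  (m <= m') -> bounded_state m s -> bounded_state m' s.
Proof.
move=> le_m [m8 regs tape]; split; first exact: leq_trans le_m.
  by move=> i; apply: magnitude_ltW (regs i).
by apply: sub_all tape => z; apply: magnitude_ltW.
Qed.

Lemma bounded_set_reg m s i z :
  bounded_state m s -> magnitude_lt m z -> bounded_state m (set_reg i z s).
Proof. by move=> [m8 regs tape] ltz; split=> //= j; case: eqP. Qed.

Lemma magnitude_lt_bits m z : (0 < m) -> magnitude_lt m z -> (bits z <= m.+1).
Proof.
rewrite /magnitude_lt /bits => m_gt0 ltz.
case: (posnP `|z|) => [->|z_gt0]; first by rewrite trunc_log0.
suff: (trunc_log 2 `|z| < m) by [].
rewrite -(ltn_exp2l _ _ (isT : 1 < 2)).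
exact: leq_ltn_trans (trunc_logP _ z_gt0) ltz.
Qed.

Lemma bits_le m s i : bounded_state m s -> (bits (reg s i) <= m.+1).
Proof. by move=> [m8 regs _]; apply: magnitude_lt_bits => //; apply: leq_trans m8. Qed.

Lemma magnitude_ltD m x y z : magnitude_lt m x -> magnitude_lt m y ->
  (`|z| <= `|x| + `|y|) -> magnitude_lt (m + 1) z.
Proof. by rewrite /magnitude_lt expnD; lia. Qed.

Lemma runs_step P s s' :
  (forall m, bounded_state m s -> bounded_state (m + 1) s' /\
     exists2 t, ram_exec P s s' t & (t <= m.+1.*2)) ->
  runs P s s' 1.
Proof.
move=> step m /step[bnd [t exec le_t]]; split=> //; exists t => //.
by apply: leq_trans le_t _; lia.
Qed.

Lemma runs_seq P Q s1 s2 s3 n1 n2 :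
  runs P s1 s2 n1 -> runs Q s2 s3 n2 -> runs (RSeq P Q) s1 s3 (n1 + n2).
Proof.
move=> runP runQ m bnd1.
have [bnd2 [t1 exec1 le_t1]] := runP m bnd1.
have [bnd3 [t2 exec2 le_t2]] := runQ _ bnd2.
rewrite addnA; split=> //; exists (t1 + t2); first exact: ExSeq exec1 exec2.
rewrite mulnDl leq_add //; apply: leq_trans le_t1 _.
by rewrite leq_mul2l; apply/orP; right; lia.
Qed.

Lemma runsW P s s' n n' : (n <= n') -> runs P s s' n -> runs P s s' n'.
Proof.
move=> le_n run m /run[bnd [t exec le_t]]; split.
  by apply: bounded_stateW bnd; lia.
exists t => //; apply: leq_trans le_t _.
by apply: leq_mul => //; lia.
Qed.

Lemma wpW P n n' (Q Q' : ram_state -> Prop) s :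
  (n <= n') -> (forall s', Q s' -> Q' s') -> wp P n Q s -> wp P n' Q' s.
Proof.
by move=> le_n QQ' [s' run Qs]; exists s'; [apply: runsW run | apply: QQ'].
Qed.

Lemma wp_seq P Q n1 n2 (C : ram_state -> Prop) s :
  wp P n1 (fun s' => wp Q n2 C s') s -> wp (RSeq P Q) (n1 + n2) C s.
Proof.
by move=> [s' runP [s'' runQ Cs]]; exists s'' => //; apply: runs_seq runP runQ.
Qed.

Lemma wp_const i z (Q : ram_state -> Prop) s :
  (`|z| < 2 ^ 8) -> Q (set_reg i z s) -> wp (RConst i z) 1 Q s.
Proof.
move=> ltz Qs; exists (set_reg i z s) => //; apply: runs_step => m bnd.
have m8 : (8 <= m) by case: bnd.
have ltzm : magnitude_lt m z by apply: magnitude_ltW m8 _.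
split; last first.
  by exists (bits z); [constructor | have := magnitude_lt_bits _ ltzm; lia].
by apply: (@bounded_stateW m); [lia | apply: bounded_set_reg].
Qed.

Lemma wp_add i j k (Q : ram_state -> Prop) s :
  Q (set_reg i (reg s j + reg s k)%R s) -> wp (RAdd i j k) 1 Q s.
Proof.
move=> Qs; exists (set_reg i (reg s j + reg s k)%R s) => //.
apply: runs_step => m bnd; split; last first.
  eexists; first exact: ExAdd.
  by have := bits_le j bnd; have := bits_le k bnd; lia.
apply: bounded_set_reg; first by apply: bounded_stateW bnd; lia.
by case: bnd => _ regs _; apply: magnitude_ltD (regs j) (regs k) _; lia.
Qed.

Lemma wp_sub i j k (Q : ram_state -> Prop) s :
  Q (set_reg i (reg s j - reg s k)%R s) -> wp (RSub i j k) 1 Q s.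
Proof.
move=> Qs; exists (set_reg i (reg s j - reg s k)%R s) => //.
apply: runs_step => m bnd; split; last first.
  eexists; first exact: ExSub.
  by have := bits_le j bnd; have := bits_le k bnd; lia.
apply: bounded_set_reg; first by apply: bounded_stateW bnd; lia.
by case: bnd => _ regs _; apply: magnitude_ltD (regs j) (regs k) _; lia.
Qed.

Lemma wp_load i j a (Q : ram_state -> Prop) s :
  reg s j = Posz a -> Q (set_reg i (reg s a) s) -> wp (RLoad i j) 1 Q s.
Proof.
move=> ja Qs; exists (set_reg i (reg s a) s) => //.
apply: runs_step => m bnd; split; last first.
  eexists; first exact: ExLoad ja.
  by have := bits_le j bnd; have := bits_le a bnd; lia.
apply: (@bounded_stateW m); first lia.
by apply: bounded_set_reg => //; case: bnd.
Qed.

Lemma wp_store i j a (Q : ram_state -> Prop) s :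
  reg s i = Posz a -> Q (set_reg a (reg s j) s) -> wp (RStore i j) 1 Q s.
Proof.
move=> ia Qs; exists (set_reg a (reg s j) s) => //.
apply: runs_step => m bnd; split; last first.
  eexists; first exact: ExStore ia.
  by have := bits_le i bnd; have := bits_le j bnd; lia.
apply: (@bounded_stateW m); first lia.
by apply: bounded_set_reg => //; case: bnd.
Qed.

Lemma wp_read i z inp (Q : ram_state -> Prop) s :
  intape s = z :: inp ->
  Q (set_reg i z (RamState (reg s) inp (outtape s))) -> wp (RRead i) 1 Q s.
Proof.
case: s => mem inp' out /= -> Qs.
exists (set_reg i z (RamState mem inp out)) => //; apply: runs_step => m bnd.
have /andP[ltz ltinp] : all (magnitude_lt m) (z :: inp) by case: bnd.
have m8 : (8 <= m) by case: bnd.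
split; last first.
  eexists; first exact: ExRead.
  by have := magnitude_lt_bits _ ltz; lia.
apply: (@bounded_stateW m); first lia.
by apply: bounded_set_reg => //; case: bnd => _ regs _; split.
Qed.

Lemma wp_print i (Q : ram_state -> Prop) s :
  Q (RamState (reg s) (intape s) (rcons (outtape s) (reg s i))) ->
  wp (RPrint i) 1 Q s.
Proof.
move=> Qs; eexists; last exact: Qs.
apply: runs_step => m bnd; split; last first.
  by eexists; [exact: ExPrint | have := bits_le i bnd; lia].
by apply: (@bounded_stateW m); [lia | case: bnd].
Qed.

(** Testing a register before running [P'] is one additional step. *)
Lemma runs_test P P' s s' i n :
  (forall t, ram_exec P' s s' t -> ram_exec P s s' (bits (reg s i) + t)) ->
  runs P' s s' n -> runs P s s' (n + 1).
Proof.
move=> test run m bnd; have [bnd' [t exec le_t]] := run m bnd; split.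
  by apply: bounded_stateW bnd'; lia.
eexists; first exact: test exec.
apply: (@leq_trans (m.+1 + n * (m + n).+1.*2)).
  by rewrite leq_add // (bits_le i bnd).
rewrite mulnDl addnC leq_add //; last lia.
by apply: leq_mul => //; lia.
Qed.

Lemma wp_if i P1 P2 n1 n2 (Q : ram_state -> Prop) s :
  wp (if (0 < reg s i)%R then P1 else P2) (if (0 < reg s i)%R then n1 else n2) Q s ->
  wp (RIfPos i P1 P2) (n1 + n2 + 1) Q s.
Proof.
case: ifP => [pos|/negbT npos] [s' run Qs]; exists s' => //.
  apply: (@runsW _ _ _ (n1 + 1)); first lia.
  by apply: runs_test run => t; apply: ExIfTrue.
apply: (@runsW _ _ _ (n2 + 1)); first lia.
by apply: runs_test run => t; apply: ExIfFalse; rewrite leNgt.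
Qed.

(** The number [k] of remaining iterations serves as the variant. *)
Lemma wp_while (Inv : nat -> ram_state -> Prop) i P c (Q : ram_state -> Prop) :
  (forall k s, Inv k.+1 s -> (0 < reg s i)%R /\ wp P c (Inv k) s) ->
  (forall s, Inv 0 s -> (reg s i <= 0)%R /\ Q s) ->
  forall n s, Inv n s -> wp (RWhilePos i P) (n * (c + 1) + 1) Q s.
Proof.
move=> loop stop; elim=> [|n IHn] s.
  move=> /stop[le0 Qs]; exists s => //; apply: runs_step => m bnd.
  split; first by apply: bounded_stateW bnd; lia.
  by eexists; [exact: ExWhileStop | have := bits_le i bnd; lia].
move=> /loop[gt0 [s1 run1 /IHn[s2 run2 Qs]]]; exists s2 => //.
have -> : (n.+1 * (c + 1) + 1 = c + (n * (c + 1) + 1) + 1) by lia.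
apply: runs_test (runs_seq run1 run2) => t exec.
inversion exec; subst; rewrite addnA; apply: ExWhileLoop; eassumption.
Qed.
(** * A small language of sums and loops *)

Notation array_base := 64 (only parsing).
Notation scratch_base := 10 (only parsing).

(** Variables are registers: 0, 1, 2 hold the ranges of loops, and 3 to 9 are loop
    variables. [EArr e] is the entry at index [e] of an array that is kept in the
    registers from [array_base] on, and [ESum x b e] is the sum of [e] for [x]
    from 0 to [X_b - 1]. Registers from [scratch_base] up to [array_base] are
    the stack of the compiled programs. *)
Inductive expr :=
| EConst (z : int)
| EVar (x : nat)
| EAdd (e1 e2 : expr)
| ESub (e1 e2 : expr)
| EArr (e : expr)
| EIfPos (e e1 e2 : expr)
| ESum (x b : nat) (e : expr).

Inductive cmd :=
| CPrint (e : expr)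
| CSeq (c1 c2 : cmd)
| CFor (x b : nat) (c : cmd).

Definition update (mem : nat -> int) (x : nat) (z : int) : nat -> int :=
  fun j => if j == x then z else mem j.

Fixpoint eval (w : seq int) (mem : nat -> int) (e : expr) : int :=
  match e with
  | EConst z => z
  | EVar x => mem x
  | EAdd e1 e2 => (eval w mem e1 + eval w mem e2)%R
  | ESub e1 e2 => (eval w mem e1 - eval w mem e2)%R
  | EArr e => if eval w mem e is Posz a then nth 0%R w a else 0%R
  | EIfPos e e1 e2 => if (0 < eval w mem e)%R then eval w mem e1 else eval w mem e2
  | ESum x b e =>
      (\sum_(i <- iota 0 `|mem b|) eval w (update mem x (Posz i)) e)%R
  end.

Fixpoint output (w : seq int) (mem : nat -> int) (c : cmd) : seq int :=
  match c with
  | CPrint e => [:: eval w mem e]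
  | CSeq c1 c2 => output w mem c1 ++ output w mem c2
  | CFor x b c =>
      flatten [seq output w (update mem x (Posz i)) c | i <- iota 0 `|mem b|]
  end.

Definition rseq (Ps : seq ram) (P : ram) : ram := foldr RSeq P Ps.

(** Runs [body] for [x] from 0 to [X_b - 1]. Register [a] is left to the body as an
    accumulator, [a + 1] saves the value of [x], [a + 2] counts the remaining
    iterations, and [a + 3] holds constants. Restoring [x] makes a loop invisible
    to its context. *)
Definition for_loop (x b a : nat) (body : ram) : ram :=
  rseq [:: RConst (a + 3) 0%R; RAdd (a + 1) x (a + 3); RAdd (a + 2) b (a + 3);
           RConst x 0%R;
           RWhilePos (a + 2) (rseq [:: body; RConst (a + 3) 1%R;
             RAdd x x (a + 3)] (RSub (a + 2) (a + 2) (a + 3)));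
           RConst (a + 3) 0%R]
       (RAdd x (a + 1) (a + 3)).

(** [d] is the register of the result and the bottom of the free stack. *)
Fixpoint compile_expr (e : expr) (d : nat) : ram :=
  match e with
  | EConst z => RConst d z
  | EVar x => RSeq (RConst d 0%R) (RAdd d x d)
  | EAdd e1 e2 =>
      rseq [:: compile_expr e1 d; compile_expr e2 d.+1] (RAdd d d d.+1)
  | ESub e1 e2 =>
      rseq [:: compile_expr e1 d; compile_expr e2 d.+1] (RSub d d d.+1)
  | EArr e =>
      (* The index is incremented first because only positivity can be tested:
         negative indices, at which the machine gets stuck, must yield 0. *)
      rseq [:: compile_expr e d; RConst d.+1 1%R; RAdd d d d.+1]
        (RIfPos d
          (rseq [:: RConst d.+1 (Posz array_base.-1); RAdd d d d.+1]
                (RLoad d d))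
          (RConst d 0%R))
  | EIfPos e e1 e2 =>
      RSeq (compile_expr e d)
        (RIfPos d (compile_expr e1 d) (compile_expr e2 d))
  | ESum x b e =>
      RSeq (RConst d 0%R)
        (for_loop x b d (RSeq (compile_expr e (d + 4)) (RAdd d d (d + 4))))
  end.

Fixpoint compile_cmd (c : cmd) (d : nat) : ram :=
  match c with
  | CPrint e => RSeq (compile_expr e d) (RPrint d)
  | CSeq c1 c2 => RSeq (compile_cmd c1 d) (compile_cmd c2 d)
  | CFor x b c => for_loop x b d (compile_cmd c (d + 4))
  end.

Definition good_loop (x b : nat) : bool :=
  (2 < x < scratch_base) && (b < 3).

(** Side conditions on a program compiled with stack bottom [d]: loops range over
    one of the registers 0, 1, 2, constants are 0 or of absolute value 1, and the
    stack does not reach the array. *)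
Fixpoint good_expr (e : expr) (d : nat) : bool :=
  match e with
  | EConst z => (`|z| <= 1) && (d < array_base)
  | EVar x => (x < scratch_base) && (d < array_base)
  | EAdd e1 e2 | ESub e1 e2 => good_expr e1 d && good_expr e2 d.+1
  | EArr e => good_expr e d && (d.+1 < array_base)
  | EIfPos e e1 e2 => [&& good_expr e d, good_expr e1 d & good_expr e2 d]
  | ESum x b e => good_loop x b && good_expr e (d + 4)
  end.

Fixpoint good_cmd (c : cmd) (d : nat) : bool :=
  match c with
  | CPrint e => good_expr e d
  | CSeq c1 c2 => good_cmd c1 d && good_cmd c2 d
  | CFor x b c => [&& good_loop x b, d + 4 < array_base & good_cmd c (d + 4)]
  end.

Definition loop_cost (N c : nat) : nat := N * (c + 4) + 7.

(** [N] stands for a bound on the ranges of the loops, so that the number of steps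
    depends on the state through [N] only. *)
Fixpoint expr_cost (e : expr) (N : nat) : nat :=
  match e with
  | EConst z => 1
  | EVar x => 2
  | EAdd e1 e2 | ESub e1 e2 => expr_cost e1 N + expr_cost e2 N + 1
  | EArr e => expr_cost e N + 7
  | EIfPos e e1 e2 => expr_cost e N + expr_cost e1 N + expr_cost e2 N + 1
  | ESum x b e => loop_cost N (expr_cost e N + 1) + 1
  end.

Fixpoint cmd_cost (c : cmd) (N : nat) : nat :=
  match c with
  | CPrint e => expr_cost e N + 1
  | CSeq c1 c2 => cmd_cost c1 N + cmd_cost c2 N
  | CFor x b c => loop_cost N (cmd_cost c N)
  end.

(** What a compiled expression leaves unchanged; the output is left out because
    loops over commands extend it. *)
Definition preserves (d : nat) (s s' : ram_state) : Prop :=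
  (forall j, (j < d) || (array_base <= j) -> reg s' j = reg s j) /\
  intape s' = intape s.

Definition well_formed (w : seq int) (N : nat) (s : ram_state) : Prop :=
  (forall j, reg s (array_base + j) = nth 0%R w j) /\
  (forall b, b < 3 -> (0 <= reg s b)%R /\ `|reg s b| <= N).

Lemma preserves_trans d d1 d2 s1 s2 s3 : d <= d1 -> d <= d2 ->
  preserves d1 s1 s2 -> preserves d2 s2 s3 -> preserves d s1 s3.
Proof.
move=> le1 le2 [r12 i12] [r23 i23]; split; last by rewrite i23.
by move=> j jP; rewrite r23 ?r12 //; lia.
Qed.

(** Expressions read no register of the stack, so that they keep their values while
    the stack is in use. *)
Lemma eval_ext w e d (mem mem' : nat -> int) :
  good_expr e d -> (forall j, j < scratch_base -> mem j = mem' j) ->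
  eval w mem e = eval w mem' e.
Proof.
elim: e d mem mem' => //=.
- by move=> x d mem mem' /andP[ltx _] ->.
- move=> e1 IH1 e2 IH2 d mem mem' /andP[g1 g2] eqm.
  by rewrite (IH1 _ _ _ g1 eqm) (IH2 _ _ _ g2 eqm).
- move=> e1 IH1 e2 IH2 d mem mem' /andP[g1 g2] eqm.
  by rewrite (IH1 _ _ _ g1 eqm) (IH2 _ _ _ g2 eqm).
- by move=> e IH d mem mem' /andP[g _] eqm; rewrite (IH _ _ _ g eqm).
- move=> e IH e1 IH1 e2 IH2 d mem mem' /and3P[g g1 g2] eqm.
  by rewrite (IH _ _ _ g eqm) (IH1 _ _ _ g1 eqm) (IH2 _ _ _ g2 eqm).
- move=> x b e IH d mem mem' /andP[/andP[_ ltb] g] eqm.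
  rewrite eqm; last by lia.
  apply: eq_bigr => i _; apply: IH g _ => j ltj.
  by rewrite /update; case: eqP => // _; apply: eqm.
Qed.

Lemma output_ext w c d (mem mem' : nat -> int) :
  good_cmd c d -> (forall j, j < scratch_base -> mem j = mem' j) ->
  output w mem c = output w mem' c.
Proof.
elim: c d mem mem' => //=.
- by move=> e d mem mem' g eqm; rewrite (eval_ext w g eqm).
- move=> c1 IH1 c2 IH2 d mem mem' /andP[g1 g2] eqm.
  by rewrite (IH1 _ _ _ g1 eqm) (IH2 _ _ _ g2 eqm).
- move=> x b c IH d mem mem' /and3P[/andP[_ ltb] _ g] eqm.
  rewrite eqm; last by lia.
  congr flatten; apply: eq_map => i; apply: IH g _ => j ltj.
  by rewrite /update; case: eqP => // _; apply: eqm.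
Qed.

Lemma well_formed_preserves w N d s s' : scratch_base <= d ->
  preserves d s s' -> well_formed w N s -> well_formed w N s'.
Proof.
move=> led [regs _] [arr dims]; split.
  by move=> j; rewrite regs ?arr //; lia.
by move=> b ltb; rewrite regs; [apply: dims | lia].
Qed.

Lemma well_formed_update w N s s' d x : scratch_base <= d -> 2 < x < d -> x < array_base ->
  (forall j, j != x -> (j < d) || (array_base <= j) -> reg s' j = reg s j) ->
  well_formed w N s -> well_formed w N s'.
Proof.
move=> led x3 xB regs [arr dims]; split.
  by move=> j; rewrite regs ?arr //; lia.
by move=> b ltb; rewrite regs; [apply: dims | lia | lia].
Qed.

Ltac reg_simpl := rewrite /=; repeat (case: eqP => ?; try lia).

(** The same rule serves sums, where the body adds [F i] to the accumulator, and
    loops over commands, where it appends [G i] to the output. *)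
Lemma wp_for_loop w N x b a body c (F : nat -> int) (G : nat -> seq int) s0 :
  good_loop x b -> scratch_base <= a -> a + 4 < array_base ->
  well_formed w N s0 ->
  (forall i s1, reg s1 x = Posz i ->
     (forall j, j != x -> (j < a) || (array_base <= j) -> reg s1 j = reg s0 j) ->
     intape s1 = intape s0 ->
     wp body c (fun s2 =>
       [/\ reg s2 a = (reg s1 a + F i)%R,
           forall j, j != a -> (j < a + 4) || (array_base <= j) ->
             reg s2 j = reg s1 j,
           intape s2 = intape s1 & outtape s2 = outtape s1 ++ G i]) s1) ->
  wp (for_loop x b a body) (loop_cost N c) (fun s2 =>
    [/\ reg s2 a = (reg s0 a + \sum_(i <- iota 0 `|reg s0 b|) F i)%R,
        preserves a s0 s2
      & outtape s2 =
        outtape s0 ++ flatten [seq G i | i <- iota 0 `|reg s0 b|]]) s0.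
Proof.
rewrite /good_loop => /andP[/andP[x3 xV] b3] a10 aB.
move=> [arr dims] body_wp; have [b_ge0 b_le] := dims b b3.
set n := `|reg s0 b|.
have nE : reg s0 b = Posz n by rewrite /n; lia.
(* [k] iterations remain, hence [x] has reached [n - k]. *)
pose Inv k s1 := [/\ k <= n, reg s1 x = Posz (n - k),
  reg s1 (a + 1) = reg s0 x /\ reg s1 (a + 2) = Posz k,
  reg s1 a = (reg s0 a + \sum_(i <- iota 0 (n - k)) F i)%R /\
  (forall j, j != x -> (j < a) || (64 <= j) -> reg s1 j = reg s0 j) &
  intape s1 = intape s0 /\
  outtape s1 = outtape s0 ++ flatten [seq G i | i <- iota 0 (n - k)]].
apply: (@wpW _ (1 + (1 + (1 + (1 + (n * (c + (1 + (1 + 1)) + 1) + 1 + (1 + 1))))))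
  _ _ _ _ _ (fun s H => H)).
  rewrite /loop_cost.
  have : n * (c + 4) <= N * (c + 4) by rewrite leq_mul2r b_le orbT.
  by lia.
rewrite /for_loop /rseq /=.
apply: wp_seq; apply: wp_const => //.
apply: wp_seq; apply: wp_add.
apply: wp_seq; apply: wp_add.
apply: wp_seq; apply: wp_const => //.
apply: wp_seq; apply: (wp_while (Inv := Inv)); last first.
- split=> //; rewrite ?subnn /= ?big_nil ?cats0 ?addr0 //.
  + by reg_simpl.
  + by split; reg_simpl; rewrite ?addr0 // -nE; lia.
  + by split=> [|j /eqP nx jP]; reg_simpl.
- move=> s1 [_ s1x [s1sv s1k] [s1a s1r] [s1i s1o]]; split; first by rewrite s1k.
  rewrite subn0 in s1a s1o; apply: wp_seq; apply: wp_const => //; apply: wp_add.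
  split; [|split|].
  + by reg_simpl.
  + move=> j jP; reg_simpl.
      by rewrite addr0 s1sv; congr (reg s0 _).
    by rewrite s1r //; lia.
  + by [].
  + by [].
move=> k s1 [le_k s1x [s1sv s1k] [s1a s1r] [s1i s1o]].
split; first by rewrite s1k.
apply: wp_seq; apply: wpW (body_wp (n - k.+1) s1 s1x s1r s1i) => // s2.
move=> [s2a s2r s2i s2o].
apply: wp_seq; apply: wp_const => //.
apply: wp_seq; apply: wp_add; apply: wp_sub.
have nk : n - k = (n - k.+1).+1 by lia.
split.
- by lia.
- reg_simpl; rewrite s2r ?s1x; lia.
- by split; reg_simpl; rewrite s2r ?s1sv ?s1k; lia.
- split; last first.
    by move=> j nx jP; reg_simpl; rewrite s2r ?s1r //; lia.
  reg_simpl; rewrite s2a s1a nk -(addn1 (n - k.+1)) iotaD /= add0n big_cat /= big_seq1.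
  by rewrite addrA.
split=> /=; first by rewrite s2i.
by rewrite s2o s1o nk -(addn1 (n - k.+1)) iotaD add0n map_cat flatten_cat /= cats0 catA.
Qed.

Lemma good_expr_lt e d : good_expr e d -> d < array_base.
Proof.
elim: e d => /=; try by [move=> * ; lia].
- by move=> e1 IH1 e2 _ d /andP[/IH1].
- by move=> e1 IH1 e2 _ d /andP[/IH1].
- by move=> e IH e1 _ e2 _ d /and3P[/IH].
- by move=> x b e IH d /andP[_ /IH]; lia.
Qed.

Lemma wp_compile_binop w N e1 e2 d s op (f : int -> int -> int) c1 c2 :
  (forall s Q, Q (set_reg d (f (reg s d) (reg s d.+1)) s) -> wp op 1 Q s) ->
  good_expr e2 d.+1 -> d < array_base ->
  scratch_base <= d -> well_formed w N s ->
  wp (compile_expr e1 d) c1 (fun s' =>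
    [/\ reg s' d = eval w (reg s) e1, preserves d s s'
      & outtape s' = outtape s]) s ->
  (forall s, well_formed w N s -> wp (compile_expr e2 d.+1) c2 (fun s' =>
    [/\ reg s' d.+1 = eval w (reg s) e2, preserves d.+1 s s'
      & outtape s' = outtape s]) s) ->
  wp (rseq [:: compile_expr e1 d; compile_expr e2 d.+1] op) (c1 + c2 + 1)
    (fun s' => [/\ reg s' d = f (eval w (reg s) e1) (eval w (reg s) e2),
       preserves d s s' & outtape s' = outtape s]) s.
Proof.
move=> wp_op g2 dB d10 wf run1 run2; rewrite -addnA.
apply: wp_seq; apply: wpW run1 => // s1 [v1 p1 o1].
apply: wp_seq; apply: wpW (run2 s1 (well_formed_preserves d10 p1 wf)) => //.
move=> s2 [v2 p2 o2]; apply: wp_op.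
rewrite (eval_ext (mem' := reg s) _ g2) in v2; last first.
  by move=> j ltj; apply: (proj1 p1); lia.
split.
- by rewrite /= eqxx v2 (proj1 p2) ?v1 //; lia.
- split=> /=; last by rewrite (proj2 p2) (proj2 p1).
  by move=> j jP; reg_simpl; rewrite (proj1 p2) ?(proj1 p1) //; lia.
- by rewrite /= o2 o1.
Qed.

Lemma wp_compile_expr w N e d s :
  good_expr e d -> scratch_base <= d -> well_formed w N s ->
  wp (compile_expr e d) (expr_cost e N) (fun s' =>
    [/\ reg s' d = eval w (reg s) e, preserves d s s'
      & outtape s' = outtape s]) s.
Proof.
elim: e d s => [z|x|e1 IH1 e2 IH2|e1 IH1 e2 IH2|e IH|e IH e1 IH1 e2 IH2|x b e IH]
  d s.
- move=> /= /andP[z1 dB] d10 wf; apply: wp_const; first by lia.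
  split; [|split|] => //; first by reg_simpl.
  by move=> j jP; reg_simpl.
- move=> /= /andP[xV dB] d10 wf.
  apply: (wp_seq (n1 := 1) (n2 := 1)); apply: wp_const => //; apply: wp_add.
  split; [|split|] => //; first by reg_simpl; rewrite addr0.
  by move=> j jP; reg_simpl.
- move=> /= g d10 wf; have dB := @good_expr_lt (EAdd e1 e2) d g; case/andP: g => g1 g2.
  apply: (wp_compile_binop (N := N)) => //; first by move=> *; apply: wp_add.
    exact: IH1.
  by move=> s1 wf1; apply: IH2 => //; lia.
- move=> /= g d10 wf; have dB := @good_expr_lt (ESub e1 e2) d g; case/andP: g => g1 g2.
  apply: (wp_compile_binop (N := N) (f := fun y z => (y - z)%R)) => //.
    by move=> *; apply: wp_sub.
    exact: IH1.
  by move=> s1 wf1; apply: IH2 => //; lia.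
- move=> /= /andP[g dB] d10 wf.
  apply: (@wpW _ (expr_cost e N + (1 + (1 + (3 + 1 + 1))))
    _ _ _ _ _ (fun s H => H)); first by lia.
  apply: wp_seq; apply: wpW (IH d s g d10 wf) => // s1 [v1 p1 o1].
  have wf1 := well_formed_preserves d10 p1 wf.
  apply: wp_seq; apply: wp_const => //.
  apply: wp_seq; apply: wp_add; apply: wp_if; rewrite [reg _ d]/= !eqxx.
  have -> : (d == d.+1) = false by lia.
  rewrite /= v1; case: (eval w (reg s) e) => a.
    have -> : (0 < Posz a + 1)%R by lia.
    apply: (wp_seq (n1 := 1) (n2 := 1 + 1)); apply: wp_const => //.
    apply: wp_seq; apply: wp_add; apply: (wp_load (a := 64 + a)).
      by reg_simpl; rewrite v1; lia.
    split=> [||//].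
      by reg_simpl; rewrite -(proj1 wf1).
    split=> [j jP|]; last exact: (proj2 p1).
    by reg_simpl; rewrite (proj1 p1).
  have -> : (0 < Negz a + 1)%R = false by lia.
  apply: (@wpW _ 1 _ _ _ _ _ (fun s H => H)) => //; apply: wp_const => //.
  split=> [||//]; first by reg_simpl.
  split=> [j jP|]; last exact: (proj2 p1).
  by reg_simpl; rewrite (proj1 p1).
- move=> /= /and3P[g g1 g2] d10 wf; rewrite -addnA -addnA.
  apply: wp_seq; apply: wpW (IH d s g d10 wf) => // s1 [v1 p1 o1].
  have wf1 := well_formed_preserves d10 p1 wf.
  have eqm j : j < 10 -> reg s1 j = reg s j by move=> ltj; apply: (proj1 p1); lia.
  rewrite addnA; apply: wp_if; rewrite v1; case: ifP => _.
  + apply: wpW (IH1 d s1 g1 d10 wf1) => // s2 [v2 p2 o2].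
    rewrite v2 (eval_ext _ g1 eqm) o2 o1; split=> //.
    exact: preserves_trans p1 p2.
  + apply: wpW (IH2 d s1 g2 d10 wf1) => // s2 [v2 p2 o2].
    rewrite v2 (eval_ext _ g2 eqm) o2 o1; split=> //.
    exact: preserves_trans p1 p2.
move=> /= /andP[gl g] d10 wf; rewrite [X in wp _ X]addnC.
have dB := good_expr_lt g.
apply: wp_seq; apply: wp_const => //.
have p1 : preserves d s (set_reg d 0%R s) by split=> //= j jP; reg_simpl.
have wf1 := well_formed_preserves d10 p1 wf.
have [/andP[x3 x10] b3] := andP gl.
apply: wpW (wp_for_loop (F := fun i => eval w (update (reg s) x (Posz i)) e)
  (G := fun=> [::]) gl d10 dB wf1 _) => //.
  move=> s2 [v2 p2 o2]; split.
  + by rewrite v2 /= eqxx add0r; reg_simpl.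
  + exact: preserves_trans p1 p2.
  + rewrite o2 /=; elim: (iota _ _) => [|i l] /=; by rewrite ?cats0.
move=> i s1 s1x s1r s1i.
have wf2 : well_formed w N s1 by apply: well_formed_update s1r wf1; lia.
apply: wp_seq; apply: wpW (IH (d + 4) s1 g _ wf2) => //; last by lia.
move=> s2 [v2 p2 o2]; apply: wp_add; split.
- reg_simpl; rewrite (proj1 p2) ?v2; last by lia.
  congr (_ + _)%R; apply: eval_ext g _ => j ltj.
  rewrite /update; case: eqP => [->//|/eqP nx].
  by rewrite s1r //=; [reg_simpl | lia].
- by move=> j nd jP; reg_simpl; rewrite (proj1 p2).
- exact: (proj2 p2).
- by rewrite cats0.
Qed.

Lemma wp_compile_cmd w N c d s :
  good_cmd c d -> scratch_base <= d -> well_formed w N s ->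
  wp (compile_cmd c d) (cmd_cost c N) (fun s' =>
    preserves d s s' /\ outtape s' = outtape s ++ output w (reg s) c) s.
Proof.
elim: c d s => [e|c1 IH1 c2 IH2|x b c IH] d s.
- move=> /= g d10 wf.
  apply: wp_seq; apply: wpW (wp_compile_expr g d10 wf) => // s1 [v1 p1 o1].
  by apply: wp_print; split=> //=; rewrite o1 v1 cats1.
- move=> /= /andP[g1 g2] d10 wf.
  apply: wp_seq; apply: wpW (IH1 d s g1 d10 wf) => // s1 [p1 o1].
  have wf1 := well_formed_preserves d10 p1 wf.
  apply: wpW (IH2 d s1 g2 d10 wf1) => // s2 [p2 o2].
  split; first exact: preserves_trans p1 p2.
  rewrite o2 o1 catA; congr (_ ++ _); apply: output_ext g2 _ => j ltj.
  by apply: (proj1 p1); lia.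
move=> /= /and3P[gl dB g] d10 wf.
have [/andP[x3 x10] b3] := andP gl.
apply: wpW (wp_for_loop (F := fun=> 0%R)
  (G := fun i => output w (update (reg s) x (Posz i)) c) gl d10 dB wf _) => //.
  by move=> s2 [_ p2 ->].
move=> i s1 s1x s1r s1i.
have wf1 : well_formed w N s1 by apply: well_formed_update s1r wf; lia.
apply: wpW (IH (d + 4) s1 g _ wf1) => //; last by lia.
move=> s2 [p2 o2]; split.
- by rewrite addr0 (proj1 p2) //; lia.
- by move=> j _ jP; rewrite (proj1 p2).
- exact: (proj2 p2).
rewrite o2; congr (_ ++ _); apply: output_ext g _ => j ltj.
rewrite /update; case: eqP => [->//|/eqP nx].
by rewrite s1r //; lia.
Qed.

(** * Polynomial time *)

Definition poly_bounded (f : nat -> nat) : Prop :=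
  exists q : {poly nat}, forall N, f N <= q.[N]%R.

Lemma poly_bounded_const a : poly_bounded (fun=> a).
Proof. by exists (a%:P)%R => N; rewrite hornerC. Qed.

Lemma poly_bounded_id : poly_bounded id.
Proof. by exists ('X)%R => N; rewrite hornerX. Qed.

Lemma poly_boundedD f g :
  poly_bounded f -> poly_bounded g -> poly_bounded (fun N => f N + g N).
Proof.
move=> [p le_p] [q le_q]; exists (p + q)%R => N; rewrite hornerD.
exact: leq_add.
Qed.

Lemma poly_boundedM f g :
  poly_bounded f -> poly_bounded g -> poly_bounded (fun N => f N * g N).
Proof.
move=> [p le_p] [q le_q]; exists (p * q)%R => N; rewrite hornerM.
exact: leq_mul.
Qed.

Lemma poly_bounded_loop f :
  poly_bounded f -> poly_bounded (fun N => loop_cost N (f N)).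
Proof.
move=> fP; apply: poly_boundedD; last exact: poly_bounded_const.
apply: poly_boundedM; first exact: poly_bounded_id.
by apply: poly_boundedD => //; apply: poly_bounded_const.
Qed.

Lemma poly_bounded_expr_cost e : poly_bounded (expr_cost e).
Proof.
elim: e => /= [z|x|e1 IH1 e2 IH2|e1 IH1 e2 IH2|e IH|e IH e1 IH1 e2 IH2|x b e IH];
  rewrite -/expr_cost;
  repeat first [exact: poly_bounded_const | assumption
    | apply: (poly_bounded_loop (f := fun N => expr_cost e N + 1))
    | apply: poly_boundedD].
Qed.

Lemma poly_bounded_cmd_cost c : poly_bounded (cmd_cost c).
Proof.
elim: c => /= [e|c1 IH1 c2 IH2|x b c IH].
- apply: poly_boundedD; last exact: poly_bounded_const.
  exact: poly_bounded_expr_cost.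
- exact: poly_boundedD.
- exact: poly_bounded_loop.
Qed.

(** Every input number is shorter than the whole input. *)
Lemma bounded_ram_init w : bounded_state (input_size w + 8) (ram_init w).
Proof.
split=> [|i|]; first by lia.
  by rewrite /magnitude_lt /= expn_gt0.
have le_bits : all (fun z => bits z <= input_size w) w.
  rewrite /input_size; elim: w => //= z w IHw; rewrite big_cons leq_addr /=.
  by apply: sub_all IHw => y; lia.
apply: sub_all le_bits => z; rewrite /bits /magnitude_lt => le_z.
by apply: leq_trans (@trunc_log_ltn 2 _ isT) _; rewrite leq_exp2l //; lia.
Qed.

(** A polynomial bound [C] on the number of steps yields the polynomial
    [C * 2 (N + C + 9)] as a bound on the time, for inputs of size [N]. *)
Lemma polytime_wp (I : Type) (O : I -> Type) (encI : I -> seq int)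
    (encO : forall D : I, O D -> seq int) (f : forall D : I, O D) P C :
  poly_bounded C ->
  (forall D, wp P (C (input_size (encI D)))
     (fun s => outtape s = encO D (f D)) (ram_init (encI D))) ->
  polytime_computable encI encO f.
Proof.
move=> Cpoly run.
have [q le_q] : poly_bounded (fun N => C N * (N + 8 + C N + 1 + (N + 8 + C N + 1))).
  by repeat first [exact: poly_bounded_const | exact: poly_bounded_id
    | assumption | apply: poly_boundedM | apply: poly_boundedD].
exists P, q => D; have [s runP out] := run D.
have [_ [t exec le_t]] := runP _ (bounded_ram_init (encI D)).
exists s, t; split=> //; apply: leq_trans le_t (leq_trans _ (le_q _)).
by rewrite leq_mul2l; apply/orP; right; lia.
Qed.

Definition dim_env (r c h : nat) : nat -> int :=
  update (update (update (fun=> 0%R) 0 (Posz r)) 1 (Posz c)) 2 (Posz h).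

(** Reads the three dimensions, computes from them by [e] how many numbers follow,
    stores these into the array and runs [c]. Register 11 points to the next cell
    of the array. *)
Definition program (e : expr) (c : cmd) : ram :=
  rseq [:: RRead 0; RRead 1; RRead 2; compile_expr e 10;
           RConst 11 (Posz array_base);
           RWhilePos 10 (rseq [:: RRead 12; RStore 11 12; RConst 12 1%R;
             RAdd 11 11 12] (RSub 10 10 12))]
       (compile_cmd c 10).

Definition program_cost (e : expr) (c : cmd) (N : nat) : nat :=
  expr_cost e N + N * 6 + cmd_cost c N + 5.

Lemma wp_program N e cm r c h w :
  good_expr e 10 -> good_cmd cm 10 -> r <= N -> c <= N -> h <= N ->
  size w <= N -> eval [::] (dim_env r c h) e = Posz (size w) ->
  wp (program e cm) (program_cost e cm N)
    (fun s => outtape s = output w (dim_env r c h) cm)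
    (ram_init ([:: Posz r; Posz c; Posz h] ++ w)).
Proof.
move=> ge gc rN cN hN wN count.
apply: (@wpW _ (1 + (1 + (1 + (expr_cost e N + (1 +
  ((size w * (1 + (1 + (1 + (1 + 1))) + 1) + 1) + cmd_cost cm N))))))
  _ _ _ _ _ (fun s H => H)).
  by rewrite /program_cost; lia.
apply: wp_seq; apply: wp_read => //.
apply: wp_seq; apply: wp_read => //.
apply: wp_seq; apply: wp_read => //.
set s1 := set_reg 2 _ _.
have s1E j : reg s1 j = dim_env r c h j by [].
have wf1 : well_formed [::] N s1.
  by split=> [j|[|[|[|]]]] //=; rewrite nth_nil.
apply: wp_seq; apply: wpW (wp_compile_expr ge _ wf1) => // s2 [s2v [s2r s2i] s2o].
rewrite (eval_ext (mem' := dim_env r c h) _ ge) // count in s2v.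
apply: wp_seq; apply: wp_const => //.
(* [k] words remain to be read, the others are in the array. *)
pose Inv k s := [/\ k <= size w, reg s 10 = Posz k,
  reg s 11 = Posz (64 + (size w - k)) /\ intape s = drop (size w - k) w,
  (forall j, j < 10 -> reg s j = dim_env r c h j) /\ outtape s = [::]
  & forall j, reg s (64 + j) = nth 0%R (take (size w - k) w) j].
apply: wp_seq; apply: (wp_while (Inv := Inv)); last first.
- split=> //; rewrite ?subnn ?drop0 ?take0 //.
  + split=> //= j ltj; reg_simpl; rewrite s2r ?s1E //; lia.
  + by move=> j /=; reg_simpl; rewrite s2r ?(proj1 wf1) //; lia.
- move=> s [_ s10 _ [sdim sout]]; rewrite subn0 take_size => sarr.
  split; first by rewrite s10.
  have wf : well_formed w N s.
    split=> // b ltb; rewrite sdim; last by lia.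
    by case: b ltb => [|[|[|]]].
  apply: wpW (wp_compile_cmd gc _ wf) => // s' [_ ->].
  by rewrite sout; apply: output_ext gc _.
move=> k s [le_k s10 [s11 stape] [sdim sout] sarr].
split; first by rewrite s10.
have nk : size w - k = (size w - k.+1).+1 by lia.
rewrite (@drop_nth int 0%R) in stape; last by lia.
apply: wp_seq; apply: wp_read stape _.
apply: wp_seq; apply: (wp_store (a := 64 + (size w - k.+1))) => //.
apply: wp_seq; apply: wp_const => //.
apply: wp_seq; apply: wp_add; apply: wp_sub.
split; first by lia.
- by reg_simpl; rewrite s10; lia.
- by split; [reg_simpl; rewrite s11; lia | rewrite /= nk].
- by split=> // j ltj; reg_simpl; apply: sdim.
move=> j; rewrite nk (@take_nth int 0%R) ?nth_rcons; last by lia.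
rewrite size_takel ?leq_subr //.
have -> : (j < size w - k.+1) = (j != size w - k.+1) && (j <= size w - k.+1).
  by rewrite ltn_neqAle.
reg_simpl; rewrite ?sarr //=; case: leqP => // ltj.
by rewrite nth_default // size_takel ?leq_subr // ltnW.
Qed.

Lemma poly_bounded_program_cost e c : poly_bounded (program_cost e c).
Proof.
by repeat first [exact: poly_bounded_const | exact: poly_bounded_id
  | exact: poly_bounded_expr_cost | exact: poly_bounded_cmd_cost
  | apply: poly_boundedM | apply: poly_boundedD].
Qed.

(** * The constructed 2-marginals *)

(** The rows are the pairs [(i,j)] in lexicographic order, so that a list over
    the rows is printed by two nested loops, see [map_row_pair]. *)
Definition row_pair (r c : nat) (q : 'I_(r * c)) : 'I_r * 'I_c :=
  enum_val (cast_ord (esym (mxvec_cast r c)) q).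

Definition col_case (T : Type) (r c h : nat) (f : 'I_r -> T) (g : 'I_c -> T)
    (e : 'I_h -> T) (q : 'I_(r + c + h)) : T :=
  match fintype.split q with
  | inl q' => match fintype.split q' with inl i => f i | inr j => g j end
  | inr k => e k
  end.

Notation col_i c h i := (lshift h (lshift c i)).
Notation col_j r h j := (lshift h (rshift r j)).
Notation col_k r c k := (rshift (r + c) k).

Definition layers (T : Type) (x y z : T) (l : 'I_3) : T := nth x [:: x; y; z] l.

Section Marginals.

Variable D : bounded_data.
Local Notation r := (bd_r D).
Local Notation c := (bd_c D).
Local Notation h := (bd_h D).

Definition upper (i : 'I_r) (j : 'I_c) (k : 'I_h) : int :=
  Posz (bd_p D (i, j, k)).

Definition upper_ij (q : 'I_r * 'I_c) : int := (\sum_k upper q.1 q.2 k)%R.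
Definition upper_i (i : 'I_r) : int := (\sum_j \sum_k upper i j k)%R.
Definition upper_j (j : 'I_c) : int := (\sum_i \sum_k upper i j k)%R.
Definition upper_k (k : 'I_h) : int := (\sum_i \sum_j upper i j k)%R.

Definition slim_ij (l : 'I_3) (q : 'I_r * 'I_c) : int := upper_ij q.

(** The sums over the rows of the table, listed by layers in each column. *)
Definition slim_ik (l : 'I_3) : 'I_(r + c + h) -> int :=
  col_case
    (fun i => layers (upper_i i - Posz (m1_i (bd_u D) i)) 0
                     (Posz (m1_i (bd_u D) i)) l)%R
    (fun j => layers 0 (Posz (m1_j (bd_u D) j))
                     (upper_j j - Posz (m1_j (bd_u D) j)) l)%R
    (fun k => layers (Posz (m1_k (bd_u D) k))
                     (upper_k k - Posz (m1_k (bd_u D) k)) 0 l)%R.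

(** The sums over the layers of the table: [P_ij] in the columns [i] and [j] that
    belong to the row [(i,j)], and [p_ijk] in column [k]. *)
Definition slim_jk (q : 'I_r * 'I_c) : 'I_(r + c + h) -> int :=
  col_case (fun i => if i == q.1 then upper_ij q else 0%R)
           (fun j => if j == q.2 then upper_ij q else 0%R)
           (fun k => upper q.1 q.2 k).

Definition slim : slim_marginals D :=
  Marginals2 [ffun lq => slim_ij lq.1 (row_pair lq.2)]
             [ffun lq => slim_ik lq.1 lq.2]
             [ffun qk => slim_jk (row_pair qk.1) qk.2].

End Marginals.

(** * Lexicographic encodings *)

Lemma codom_pair (A B : finType) (T : Type) (F : A -> B -> T) :
  codom [ffun ab : A * B => F ab.1 ab.2] =
  flatten [seq [seq F a b | b <- enum B] | a <- enum A].
Proof.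
have -> : codom [ffun ab : A * B => F ab.1 ab.2] = [seq F ab.1 ab.2 | ab <- enum {: A * B}].
  by rewrite codomE; apply: eq_map => ab; rewrite ffunE.
rewrite [enum _]enumT unlock /= /prod_enum map_flatten -map_comp.
by congr flatten; apply: eq_map => a /=; rewrite -map_comp.
Qed.

Lemma map_enum_val (T : finType) n (eq_n : n = #|T|) :
  [seq enum_val (cast_ord eq_n q) | q <- enum 'I_n] = enum T.
Proof.
case: n eq_n => [|n] eq_n.
  by rewrite enum_ord0 (size0nil (s := enum T)) // -cardE -eq_n.
pose x0 : T := enum_val (cast_ord eq_n ord0).
rewrite -[RHS](mkseq_nth x0) /mkseq -cardE -[X in iota 0 X]eq_n -val_enum_ord -map_comp.
by apply: eq_map => q /=; rewrite (enum_val_nth x0).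
Qed.

Lemma map_row_pair (r c : nat) (T : Type) (F : 'I_r * 'I_c -> T) :
  [seq F (row_pair q) | q <- enum 'I_(r * c)] =
  flatten [seq [seq F (i, j) | j <- enum 'I_c] | i <- enum 'I_r].
Proof.
rewrite -(codom_pair (fun i j => F (i, j))) codomE.
rewrite -(map_enum_val (esym (mxvec_cast r c))) -map_comp.
by apply: eq_map => q /=; rewrite ffunE -surjective_pairing.
Qed.

Lemma enum_ord_add (m n : nat) :
  enum 'I_(m + n) =
  [seq lshift n i | i <- enum 'I_m] ++ [seq rshift m i | i <- enum 'I_n].
Proof.
apply: (inj_map val_inj); rewrite val_enum_ord map_cat.
rewrite -(map_comp val (lshift n)) -(map_comp val (@rshift m n)).
rewrite iotaD -[X in iota X n]addn0 iotaDl -!val_enum_ord -(map_comp (addn _)).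
by congr (_ ++ _); apply: eq_map.
Qed.

Lemma map_col_case (r c h : nat) (T : Type) (f : 'I_r -> T) (g : 'I_c -> T) (e : 'I_h -> T) :
  [seq col_case f g e q | q <- enum 'I_(r + c + h)] =
  [seq f i | i <- enum 'I_r] ++ [seq g j | j <- enum 'I_c] ++
  [seq e k | k <- enum 'I_h].
Proof.
rewrite !enum_ord_add !map_cat -!map_comp -catA.
congr (_ ++ (_ ++ _)); apply: eq_map => i /=; rewrite /col_case.
- by rewrite !(unsplitK (inl _)).
- by rewrite (unsplitK (inl _)) (unsplitK (inr _)).
- by rewrite (unsplitK (inr _)).
Qed.

Lemma map_iota_enum n (T : Type) (F : 'I_n -> T) (G : nat -> T) :
  (forall i : 'I_n, G i = F i) -> [seq G i | i <- iota 0 n] = [seq F i | i <- enum 'I_n].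
Proof.
by move=> GF; rewrite -val_enum_ord -map_comp; apply: eq_map => i /=.
Qed.

Lemma sum_iota_ord n (F : 'I_n -> int) (G : nat -> int) :
  (forall i : 'I_n, G i = F i) -> (\sum_(i <- iota 0 n) G i = \sum_i F i)%R.
Proof.
by move=> GF; rewrite -[n in LHS]subn0 big_mkord; apply: eq_bigr => i _.
Qed.

Lemma index_allpairs (A B : eqType) (s : seq A) (t : seq B) a b :
  a \in s -> b \in t ->
  index (a, b) [seq (x, y) | x <- s, y <- t] = index a s * size t + index b t.
Proof.
elim: s => //= x s IHs; rewrite inE index_cat => ain bt.
case: (eqVneq x a) => [->|nxa].
  rewrite map_f // index_map ?mul0n // => y y' [] //.
have -> : ((a, b) \in [seq (x, y) | y <- t]) = false.
  by apply/mapP => -[y _ [ax]]; rewrite ax eqxx in nxa.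
rewrite size_map IHs ?mulSn ?addnA //.
by case/orP: ain => // /eqP ax; rewrite ax eqxx in nxa.
Qed.

(** The position of an entry in the encoding of an array: the index arithmetic that
    the program has to perform. *)
Lemma enum_rank_pair (A B : finType) (a : A) (b : B) :
  enum_rank (a, b) = enum_rank a * #|B| + enum_rank b :> nat.
Proof.
have rankE (T : finType) (x : T) : enum_rank x = index x (enum T) :> nat.
  rewrite -{2}(enum_rankK x) (enum_val_nth x).
  by rewrite index_uniq ?enum_uniq // -cardE.
rewrite !rankE [enum {: A * B}]enumT unlock /= /prod_enum.
by rewrite index_allpairs ?mem_enum // -cardE.
Qed.

(** * A program for the constructed 2-marginals *)

(** The machine has no multiplication; a product by a range is a sum of equal
    terms. Register 6 is reserved for its index. *)
Definition EMulDim (b : nat) (e : expr) : expr := ESum 6 b e.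

(** The value is 0 if the two registers differ. *)
Definition EIfEq (x y : nat) (e : expr) : expr :=
  EIfPos (ESub (EVar x) (EVar y)) (EConst 0%R)
    (EIfPos (ESub (EVar y) (EVar x)) (EConst 0%R) e).

Definition EDims : expr := EAdd (EAdd (EVar 0) (EVar 1)) (EVar 2).
Definition ECount : expr := EAdd EDims (EMulDim 0 (EMulDim 1 (EVar 2))).

(** The input after the dimensions lists [u_i], [u_j], [u_k], and [p_ijk] in
    lexicographic order. Registers 3, 4, 5 stand for [i], [j], [k]. *)
Definition EMarginal_i : expr := EArr (EVar 3).
Definition EMarginal_j : expr := EArr (EAdd (EVar 0) (EVar 4)).
Definition EMarginal_k : expr := EArr (EAdd (EAdd (EVar 0) (EVar 1)) (EVar 5)).
Definition EUpper : expr :=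
  EArr (EAdd EDims
    (EAdd (EMulDim 2 (EAdd (EMulDim 1 (EVar 3)) (EVar 4))) (EVar 5))).

Definition EUpper_ij : expr := ESum 5 2 EUpper.
Definition EUpper_i : expr := ESum 4 1 (ESum 5 2 EUpper).
Definition EUpper_j : expr := ESum 3 0 (ESum 5 2 EUpper).
Definition EUpper_k : expr := ESum 3 0 (ESum 4 1 EUpper).

Definition CSlim_ij : cmd := CFor 3 0 (CFor 4 1 (CPrint EUpper_ij)).

Definition CLayer (e_i e_j e_k : expr) : cmd :=
  CSeq (CFor 3 0 (CPrint e_i))
       (CSeq (CFor 4 1 (CPrint e_j)) (CFor 5 2 (CPrint e_k))).

Definition CSlim_ik : cmd :=
  CSeq (CLayer (ESub EUpper_i EMarginal_i) (EConst 0%R) EMarginal_k)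
  (CSeq (CLayer (EConst 0%R) EMarginal_j (ESub EUpper_k EMarginal_k))
        (CLayer EMarginal_i (ESub EUpper_j EMarginal_j) (EConst 0%R))).

Definition CSlim_jk : cmd :=
  CFor 3 0 (CFor 4 1
    (CSeq (CFor 7 0 (CPrint (EIfEq 7 3 EUpper_ij)))
    (CSeq (CFor 7 1 (CPrint (EIfEq 7 4 EUpper_ij)))
          (CFor 5 2 (CPrint EUpper))))).

Definition CSlim : cmd :=
  CSeq (CSeq CSlim_ij (CSeq CSlim_ij CSlim_ij)) (CSeq CSlim_ik CSlim_jk).

Lemma eval_EAdd w mem e1 e2 :
  eval w mem (EAdd e1 e2) = (eval w mem e1 + eval w mem e2)%R.
Proof. by []. Qed.

Lemma eval_ESub w mem e1 e2 :
  eval w mem (ESub e1 e2) = (eval w mem e1 - eval w mem e2)%R.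
Proof. by []. Qed.

Lemma eval_EArr w mem e a :
  eval w mem e = Posz a -> eval w mem (EArr e) = nth 0%R w a.
Proof. by move=> /= ->. Qed.

Lemma eval_ESum w mem x b e n (F : 'I_n -> int) : mem b = Posz n ->
  (forall i : 'I_n, eval w (update mem x (Posz i)) e = F i) ->
  eval w mem (ESum x b e) = (\sum_i F i)%R.
Proof. by move=> /= -> eF; rewrite (sum_iota_ord eF). Qed.

Lemma eval_EMulDim w mem b e :
  (forall i, eval w (update mem 6 i) e = eval w mem e) ->
  eval w mem (EMulDim b e) = (eval w mem e * Posz `|mem b|)%R.
Proof.
move=> indep /=; rewrite (eq_bigr (fun=> eval w mem e)) => [|i _].
  by rewrite big_const_seq count_predT size_iota iter_addr addr0 -mulr_natr natz.
exact: indep.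
Qed.

Lemma eval_EIfEq w mem x y e a b : mem x = Posz a -> mem y = Posz b ->
  eval w mem (EIfEq x y e) = if a == b then eval w mem e else 0%R.
Proof.
move=> /= -> ->; case: (ltngtP a b) => ab.
- by have [-> ->] : (0 < Posz a - Posz b)%R = false /\ (0 < Posz b - Posz a)%R by lia.
- by have -> : (0 < Posz a - Posz b)%R by lia.
- by rewrite ab subrr.
Qed.

(** ** Values of the expressions and output of the commands *)

Section Program.

Variable D : bounded_data.
Local Notation r := (bd_r D).
Local Notation c := (bd_c D).
Local Notation h := (bd_h D).

Definition data_words : seq int :=
  map Posz (codom (m1_i (bd_u D)) ++ codom (m1_j (bd_u D)) ++
            codom (m1_k (bd_u D)) ++ codom (bd_p D)).

Lemma size_data_words : size data_words = r + c + h + r * c * h.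
Proof. by rewrite size_map !size_cat !size_codom !card_prod !card_ord !addnA. Qed.

Lemma nth_codom_rank (T : finType) (f : T -> nat) x (n : nat) :
  n = enum_rank x :> nat -> nth 0 (codom f) n = f x.
Proof. by move=> ->; rewrite nth_codom enum_rankK. Qed.

Lemma nth_data_words n : nth 0%R data_words n =
  Posz (nth 0 (codom (m1_i (bd_u D)) ++ codom (m1_j (bd_u D)) ++
               codom (m1_k (bd_u D)) ++ codom (bd_p D)) n).
Proof.
rewrite /data_words; case: (ltnP n (r + c + h + r * c * h)) => ltn.
  by rewrite (nth_map 0) // -(size_map Posz) -/data_words size_data_words.
by rewrite !nth_default // -?(size_map Posz) -/data_words ?size_data_words.
Qed.

Lemma word_i (i : 'I_r) : nth 0%R data_words i = Posz (m1_i (bd_u D) i).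
Proof.
rewrite nth_data_words nth_cat size_codom card_ord ltn_ord /=.
by congr Posz; apply: (@nth_codom_rank _ _ i); rewrite enum_rank_ord.
Qed.

Lemma word_j (j : 'I_c) : nth 0%R data_words (r + j) = Posz (m1_j (bd_u D) j).
Proof.
rewrite nth_data_words !nth_cat !size_codom !card_ord ltnNge leq_addr addKn ltn_ord /=.
by congr Posz; apply: (@nth_codom_rank _ _ j); rewrite enum_rank_ord.
Qed.

Lemma word_k (k : 'I_h) :
  nth 0%R data_words (r + c + k) = Posz (m1_k (bd_u D) k).
Proof.
rewrite nth_data_words !nth_cat !size_codom !card_ord -addnA.
rewrite ltnNge leq_addr addKn ltnNge leq_addr addKn ltn_ord /=.
by congr Posz; apply: (@nth_codom_rank _ _ k); rewrite enum_rank_ord.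
Qed.

Lemma word_ijk (i : 'I_r) (j : 'I_c) (k : 'I_h) :
  nth 0%R data_words (r + c + h + ((i * c + j) * h + k)) = upper i j k.
Proof.
rewrite nth_data_words !nth_cat !size_codom !card_ord -!(addnA r) -!(addnA c).
rewrite ltnNge leq_addr addKn /=.
rewrite ltnNge leq_addr addKn /= ltnNge leq_addr addKn /=.
by congr Posz; apply: (@nth_codom_rank _ _ (i, j, k));
  rewrite !enum_rank_pair !enum_rank_ord /= !card_ord.
Qed.

Definition has_dims (mem : nat -> int) : Prop :=
  [/\ mem 0 = Posz r, mem 1 = Posz c & mem 2 = Posz h].

Local Notation w := data_words.

Lemma eval_EUpper mem (i : 'I_r) (j : 'I_c) (k : 'I_h) : has_dims mem ->
  mem 3 = Posz i -> mem 4 = Posz j -> mem 5 = Posz k ->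
  eval w mem EUpper = upper i j k.
Proof.
move=> [m0 m1 m2] m3 m4 m5.
have indep z : eval w (update mem 6 z) (EAdd (EMulDim 1 (EVar 3)) (EVar 4)) =
               eval w mem (EAdd (EMulDim 1 (EVar 3)) (EVar 4)) by [].
rewrite -word_ijk; apply: eval_EArr.
rewrite 2!eval_EAdd (eval_EMulDim 2 indep) eval_EAdd eval_EMulDim //=.
by rewrite m0 m1 m2 m3 m4 m5 !PoszD !PoszM.
Qed.

Lemma eval_EUpper_ij mem (i : 'I_r) (j : 'I_c) : has_dims mem ->
  mem 3 = Posz i -> mem 4 = Posz j -> eval w mem EUpper_ij = upper_ij (i, j).
Proof.
move=> dims m3 m4; have [m0 m1 m2] := dims.
by apply: eval_ESum => // k; apply: eval_EUpper.
Qed.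

Lemma eval_EUpper_i mem (i : 'I_r) : has_dims mem ->
  mem 3 = Posz i -> eval w mem EUpper_i = upper_i i.
Proof.
move=> dims m3; have [m0 m1 m2] := dims.
by apply: eval_ESum => // j; apply: (eval_EUpper_ij (i := i) (j := j)).
Qed.

Lemma eval_EUpper_j mem (j : 'I_c) : has_dims mem ->
  mem 4 = Posz j -> eval w mem EUpper_j = upper_j j.
Proof.
move=> dims m4; have [m0 m1 m2] := dims.
by apply: eval_ESum => // i; apply: (eval_EUpper_ij (i := i) (j := j)).
Qed.

Lemma eval_EUpper_k mem (k : 'I_h) : has_dims mem ->
  mem 5 = Posz k -> eval w mem EUpper_k = upper_k k.
Proof.
move=> dims m5; have [m0 m1 m2] := dims.
by apply: eval_ESum => // i; apply: eval_ESum => // j; apply: eval_EUpper.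
Qed.

Lemma eval_EMarginal_i mem (i : 'I_r) :
  mem 3 = Posz i -> eval w mem EMarginal_i = Posz (m1_i (bd_u D) i).
Proof. by move=> m3; rewrite -word_i; apply: eval_EArr. Qed.

Lemma eval_EMarginal_j mem (j : 'I_c) : has_dims mem ->
  mem 4 = Posz j -> eval w mem EMarginal_j = Posz (m1_j (bd_u D) j).
Proof. by move=> [m0 _ _] m4; rewrite -word_j; apply: eval_EArr; rewrite /= m0 m4. Qed.

Lemma eval_EMarginal_k mem (k : 'I_h) : has_dims mem ->
  mem 5 = Posz k -> eval w mem EMarginal_k = Posz (m1_k (bd_u D) k).
Proof. by move=> [m0 m1 _] m5; rewrite -word_k; apply: eval_EArr; rewrite /= m0 m1 m5. Qed.

Lemma output_CFor_CPrint mem x b e n (F : 'I_n -> int) : mem b = Posz n ->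
  (forall i : 'I_n, eval w (update mem x (Posz i)) e = F i) ->
  output w mem (CFor x b (CPrint e)) = [seq F i | i <- enum 'I_n].
Proof.
move=> bE eF; pose G (i : nat) := eval w (update mem x (Posz i)) e.
rewrite -(map_iota_enum (G := G) eF) /= bE.
by elim: (iota 0 n) => //= i s ->.
Qed.

Lemma output_CFor mem x b cm n (F : 'I_n -> seq int) : mem b = Posz n ->
  (forall i : 'I_n, output w (update mem x (Posz i)) cm = F i) ->
  output w mem (CFor x b cm) = flatten [seq F i | i <- enum 'I_n].
Proof.
move=> bE eF.
by rewrite -(map_iota_enum (G := fun i => output w (update mem x (Posz i)) cm) eF) /= bE.
Qed.

Lemma output_CSlim_ij mem l : has_dims mem -> output w mem CSlim_ij =
  [seq @slim_ij D l (row_pair q) | q <- enum 'I_(r * c)].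
Proof.
move=> dims; have [m0 m1 _] := dims; rewrite map_row_pair.
apply: output_CFor => // i; apply: output_CFor_CPrint => // j.
exact: eval_EUpper_ij.
Qed.

Lemma output_CLayer mem e_i e_j e_k f g e : has_dims mem ->
  (forall i : 'I_r, eval w (update mem 3 (Posz i)) e_i = f i) ->
  (forall j : 'I_c, eval w (update mem 4 (Posz j)) e_j = g j) ->
  (forall k : 'I_h, eval w (update mem 5 (Posz k)) e_k = e k) ->
  output w mem (CLayer e_i e_j e_k) =
  [seq col_case f g e q | q <- enum 'I_(r + c + h)].
Proof.
move=> [m0 m1 m2] fP gP eP; rewrite map_col_case.
by congr (_ ++ (_ ++ _)); apply: output_CFor_CPrint.
Qed.

Lemma flatten_ord3 (T : Type) (A : 'I_3 -> seq T) :
  flatten [seq A l | l <- enum 'I_3] =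
  A ord0 ++ (A (lift ord0 ord0) ++ A (lift ord0 (lift ord0 ord0))).
Proof. by rewrite !enum_ordSl enum_ord0 /= cats0. Qed.

Lemma output_CSlim_ik mem : has_dims mem -> output w mem CSlim_ik =
  flatten [seq [seq @slim_ik D l q | q <- enum 'I_(r + c + h)] | l <- enum 'I_3].
Proof.
move=> dims.
rewrite flatten_ord3 /slim_ik; congr (_ ++ (_ ++ _)); apply: output_CLayer => // x.
- by rewrite eval_ESub (eval_EUpper_i (i := x)) ?(eval_EMarginal_i (i := x)).
- exact: eval_EMarginal_k.
- exact: eval_EMarginal_j.
- by rewrite eval_ESub (eval_EUpper_k (k := x)) ?(eval_EMarginal_k (k := x)).
- exact: eval_EMarginal_i.
- by rewrite eval_ESub (eval_EUpper_j (j := x)) ?(eval_EMarginal_j (j := x)).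
Qed.

Lemma output_CSlim_jk mem : has_dims mem -> output w mem CSlim_jk =
  flatten [seq [seq @slim_jk D (row_pair q) q' | q' <- enum 'I_(r + c + h)]
          | q <- enum 'I_(r * c)].
Proof.
move=> dims; have [m0 m1 m2] := dims.
rewrite (map_row_pair (fun ij => [seq slim_jk ij q' | q' <- enum 'I_(r + c + h)])).
have flatten2 (sss : seq (seq (seq int))) :
    flatten (flatten sss) = flatten [seq flatten ss | ss <- sss].
  by elim: sss => //= ss sss IH; rewrite flatten_cat IH.
rewrite flatten2 -map_comp.
apply: output_CFor => // i; apply: output_CFor => // j.
rewrite /slim_jk map_col_case; congr (_ ++ (_ ++ _)).
- apply: output_CFor_CPrint => // i'.
  by rewrite (@eval_EIfEq _ _ 7 3 EUpper_ij i' i) // (eval_EUpper_ij (i := i) (j := j)) //.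
- apply: output_CFor_CPrint => // j'.
  by rewrite (@eval_EIfEq _ _ 7 4 EUpper_ij j' j) // (eval_EUpper_ij (i := i) (j := j)).
- by apply: output_CFor_CPrint => // k; apply: eval_EUpper.
Qed.

Lemma output_CSlim mem :
  has_dims mem -> output w mem CSlim = encode_marginals2 (slim D).
Proof.
move=> dims; rewrite /encode_marginals2.
rewrite [codom (m2_ij _)](codom_pair (fun l q => slim_ij l (row_pair q))).
rewrite [codom (m2_ik _)](codom_pair (fun l q => slim_ik l q)).
rewrite [codom (m2_jk _)](codom_pair (fun q q' => slim_jk (row_pair q) q')).
rewrite -(output_CSlim_ik dims) -(output_CSlim_jk dims).
by rewrite flatten_ord3 -!(output_CSlim_ij _ dims).
Qed.

End Program.

(** The input has at least [r + c + h] numbers, so the ranges are bounded by its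
    size. *)
Theorem polytime_slim :
  polytime_computable encode_bounded_data
    (fun (D : bounded_data) (v : slim_marginals D) => encode_marginals2 v) slim.
Proof.
apply: (polytime_wp (P := program ECount CSlim)
  (poly_bounded_program_cost ECount CSlim)) => D.
have size_ge (s : seq int) : size s <= input_size s.
  by rewrite /input_size; elim: s => //= z s IHs; rewrite big_cons -add1n leq_add.
have := size_ge (encode_bounded_data D); set N := input_size _ => leN.
rewrite -(output_CSlim (mem := dim_env (bd_r D) (bd_c D) (bd_h D))) //.
have sizeE := size_data_words D.
have {}leN : size (data_words D) + 3 <= N.
  by apply: leq_trans leN; rewrite /= -/(data_words D) -/(cat _ _) addnC.
apply: wp_program => //; try lia.
rewrite sizeE /ECount eval_EAdd eval_EMulDim => [|i]; rewrite !eval_EMulDim //=.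
by rewrite /dim_env /update /=; lia.
Qed.

(** * The bijection *)

Definition row_index (r c : nat) (ij : 'I_r * 'I_c) : 'I_(r * c) :=
  cast_ord (mxvec_cast r c) (enum_rank ij).

Lemma row_indexK r c : cancel (@row_index r c) (@row_pair r c).
Proof. by move=> ij; rewrite /row_pair /row_index cast_ordK enum_rankK. Qed.

Lemma row_pairK r c : cancel (@row_pair r c) (@row_index r c).
Proof. by move=> q; rewrite /row_pair /row_index enum_valK cast_ordKV. Qed.

Lemma col_case_i T r c h f g e i :
  @col_case T r c h f g e (col_i c h i) = f i.
Proof. by rewrite /col_case !(unsplitK (inl _)). Qed.

Lemma col_case_j T r c h f g e j :
  @col_case T r c h f g e (col_j r h j) = g j.
Proof. by rewrite /col_case (unsplitK (inl _)) (unsplitK (inr _)). Qed.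

Lemma col_case_k T r c h f g e k :
  @col_case T r c h f g e (col_k r c k) = e k.
Proof. by rewrite /col_case (unsplitK (inr _)). Qed.

Definition col_caseE := (col_case_i, col_case_j, col_case_k).

Variant col_spec r c h : 'I_(r + c + h) -> Prop :=
| ColI i : col_spec (col_i c h i)
| ColJ j : col_spec (col_j r h j)
| ColK k : col_spec (col_k r c k).

Lemma colP r c h (q : 'I_(r + c + h)) : col_spec q.
Proof.
case: (split_ordP q) => [q' ->|k ->]; last exact: ColK.
by case: (split_ordP q') => [i ->|j ->]; [exact: ColI | exact: ColJ].
Qed.

Notation l0 := (@ord0 2).
Notation l1 := (lift (@ord0 2) (@ord0 1)).
Notation l2 := (lift (@ord0 2) (lift (@ord0 1) (@ord0 0))).

Variant layer_spec : 'I_3 -> Prop :=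
| Layer0 : layer_spec l0
| Layer1 : layer_spec l1
| Layer2 : layer_spec l2.

Lemma layerP l : layer_spec l.
Proof.
case: (unliftP l0 l) => [l' ->|->]; last exact: Layer0.
case: (unliftP (@ord0 1) l') => [l'' ->|->]; last exact: Layer1.
by rewrite (ord1 l''); exact: Layer2.
Qed.

Lemma layersE T (x y z : T) :
  ((layers x y z l0 = x) * (layers x y z l1 = y) * (layers x y z l2 = z))%type.
Proof. by []. Qed.

Local Open Scope ring_scope.

Section Sums.

Variable V : nmodType.

Lemma sum_rows r c (F : 'I_r * 'I_c -> V) :
  \sum_q F (row_pair q) = \sum_i \sum_j F (i, j).
Proof.
rewrite (reindex (@row_index r c)) /=; last first.
  by exists (@row_pair r c) => q _; [apply: row_indexK | apply: row_pairK].
rewrite pair_bigA /=; apply: eq_bigr => -[i j] _.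
by rewrite row_indexK.
Qed.

Lemma sum_cols r c h (F : 'I_(r + c + h) -> V) :
  \sum_q F q = \sum_i F (col_i c h i) + \sum_j F (col_j r h j) +
               \sum_k F (col_k r c k).
Proof. by rewrite !big_split_ord. Qed.

Lemma sum_layers (F : 'I_3 -> V) : \sum_l F l = F l0 + F l1 + F l2.
Proof. by rewrite !big_ord_recl big_ord0 addr0 addrA. Qed.

(** Only one of the columns [i'], [j'] of a row contributes to its sums. *)
Lemma sum_diag n (i0 : 'I_n) (F : 'I_n -> V) :
  \sum_i (if i == i0 then F i else 0) = F i0.
Proof. by rewrite -big_mkcond big_pred1_eq. Qed.

End Sums.

Lemma sum_row_eq0 (R : realType) r c (F : 'I_r -> 'I_c -> R) :
  (forall i j, 0 <= F i j) -> \sum_i \sum_j F i j = 0 -> forall i j, F i j = 0.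
Proof.
move=> F_ge0 sum0 i j.
have row0 : \sum_j' F i j' = 0.
  by apply: psumr_eq0P sum0 i _ => // i' _; apply: sumr_ge0.
by apply: psumr_eq0P row0 j _.
Qed.

Section Bijection.

Variables (R : realType) (D : bounded_data).
Local Notation r := (bd_r D).
Local Notation c := (bd_c D).
Local Notation h := (bd_h D).
Local Notation arrays := (real_array R r c h).

Definition line_sum (x : arrays) (ij : 'I_r * 'I_c) : R :=
  \sum_k (x (ij.1, ij.2, k) : R).

(** The table of the construction. It is linear in the pair [(p, x)], which is why
    the upper bounds are taken as a real array: the linear part of the map
    [slim_array p] is then [slim_array 0], and its constant part is
    [slim_array p 0]. *)
Definition slim_entry (p x : arrays) (l : 'I_3) (ij : 'I_r * 'I_c) :
    'I_(r + c + h) -> R :=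
  col_case
    (fun i => if i == ij.1
       then layers (line_sum p ij - line_sum x ij) 0 (line_sum x ij) l else 0)
    (fun j => if j == ij.2
       then layers 0 (line_sum x ij) (line_sum p ij - line_sum x ij) l else 0)
    (fun k => layers (x (ij.1, ij.2, k) : R)
       ((p (ij.1, ij.2, k) : R) - (x (ij.1, ij.2, k) : R)) 0 l).

Definition slim_array (p x : arrays) : real_array R 3 (r * c) (r + c + h) :=
  [ffun q => slim_entry p x q.1.1 (row_pair q.1.2) q.2].

Lemma line_sum_linear a x y ij :
  line_sum (a *: x + y) ij = a * line_sum x ij + line_sum y ij.
Proof.
rewrite /line_sum mulr_sumr -big_split /=; apply: eq_bigr => k _.
by rewrite !ffunE.
Qed.

Lemma slim_entry_linear a p q x y l ij K :
  slim_entry (a *: p + q) (a *: x + y) l ij K =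
  a * slim_entry p x l ij K + slim_entry q y l ij K.
Proof.
rewrite /slim_entry; case: (colP K) => [i|j|k]; rewrite !col_caseE ?line_sum_linear.
- by case: eqP => _; case: (layerP l); rewrite ?layersE; ring.
- by case: eqP => _; case: (layerP l); rewrite ?layersE; ring.
- by rewrite !ffunE -![_ *: _]/(_ * _); case: (layerP l); rewrite ?layersE; ring.
Qed.

Lemma slim_array_linear : linear (slim_array 0).
Proof.
move=> a x y; apply/ffunP => q; rewrite !ffunE -[RHS]/(a * _ + _).
by rewrite -slim_entry_linear scaler0 addr0.
Qed.

HB.instance Definition _ :=
  GRing.isLinear.Build R arrays (real_array R 3 (r * c) (r + c + h)) _
    (slim_array 0) slim_array_linear.

Lemma affine_slim_array p : affine_map (slim_array p).
Proof.
exists (slim_array 0 : {linear _ -> _}), (slim_array p 0) => x.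
apply/ffunP => q; rewrite !ffunE -[slim_entry 0 _ _ _ _]mul1r.
by rewrite -slim_entry_linear !scale1r add0r addr0.
Qed.

Definition upper_array : arrays := [ffun q => (bd_p D q)%:R].

Local Notation p := upper_array.

Lemma upperE i j k : (upper i j k)%:~R = (p (i, j, k) : R).
Proof. by rewrite ffunE -pmulrn. Qed.

Lemma upper_ijE ij : (upper_ij ij)%:~R = line_sum p ij :> R.
Proof. by rewrite rmorph_sum; apply: eq_bigr => k _; apply: upperE. Qed.

Lemma upper_iE i : (upper_i i)%:~R = \sum_j line_sum p (i, j) :> R.
Proof. by rewrite rmorph_sum; apply: eq_bigr => j _; apply: upper_ijE (i, j). Qed.

Lemma upper_jE j : (upper_j j)%:~R = \sum_i line_sum p (i, j) :> R.
Proof. by rewrite rmorph_sum; apply: eq_bigr => i _; apply: upper_ijE (i, j). Qed.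

Lemma upper_kE k : (upper_k k)%:~R = \sum_i \sum_j (p (i, j, k) : R).
Proof.
rewrite rmorph_sum; apply: eq_bigr => i _; rewrite rmorph_sum.
by apply: eq_bigr => j _; apply: upperE.
Qed.

Lemma line_sum_bounds x ij : @bounded_arrays R D x ->
  0 <= line_sum x ij /\ line_sum x ij <= line_sum p ij.
Proof.
case=> x_ge0 x_le _; split; first by apply: sumr_ge0.
by apply: ler_sum => k _; rewrite [p _]ffunE.
Qed.

Lemma slim_array_marginals x : has_1marginals (bd_u D) x ->
  has_2marginals (slim D) (slim_array p x).
Proof.
case=> u_i u_j u_k; split.
- move=> l q; rewrite ffunE /= /slim_ij upper_ijE.
  under eq_bigr => K _ do rewrite ffunE /=.
  set ij := row_pair q; rewrite sum_cols /slim_entry.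
  under eq_bigr => i _ do rewrite !col_caseE.
  rewrite sum_diag; under eq_bigr => i _ do rewrite !col_caseE.
  rewrite sum_diag; under eq_bigr => i _ do rewrite !col_caseE.
  case: (layerP l); rewrite ?layersE; under eq_bigr => k _ do rewrite ?layersE.
  + by rewrite -/(line_sum x ij); ring.
  + by rewrite sumrB -/(line_sum x ij) -/(line_sum p ij); ring.
  + by rewrite big1 //; ring.
- move=> l K; rewrite ffunE /=.
  under eq_bigr => q _ do rewrite ffunE /=.
  rewrite (sum_rows (fun ij => slim_entry p x l ij K)) /slim_entry /slim_ik.
  case: (colP K) => [i|j|k]; rewrite !col_caseE;
    under eq_bigr => i' _ do under eq_bigr => j' _ do rewrite !col_caseE /=.
  + have diag (F : 'I_r -> 'I_c -> R) :
        \sum_i' \sum_j (if i == i' then F i' j else 0) = \sum_j F i j.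
      rewrite exchange_big; apply: eq_bigr => j _ /=.
      by under eq_bigr => i' _ do rewrite eq_sym; rewrite sum_diag.
    rewrite diag; case: (layerP l); rewrite ?layersE;
      under eq_bigr => j _ do rewrite ?layersE.
    * by rewrite sumrB rmorphB /= upper_iE -pmulrn -u_i.
    * by rewrite big1.
    * by rewrite -pmulrn -u_i.
  + have diag (F : 'I_r -> 'I_c -> R) :
        \sum_i \sum_j' (if j == j' then F i j' else 0) = \sum_i F i j.
      apply: eq_bigr => i _.
      by under eq_bigr => j' _ do rewrite eq_sym; rewrite sum_diag.
    rewrite diag; case: (layerP l); rewrite ?layersE;
      under eq_bigr => i _ do rewrite ?layersE.
    * by rewrite big1.
    * by rewrite -pmulrn -u_j.
    * by rewrite sumrB rmorphB /= upper_jE -pmulrn -u_j.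
  + case: (layerP l); rewrite ?layersE;
      under eq_bigr => i _ do under eq_bigr => j _ do rewrite ?layersE.
    * by rewrite -pmulrn -u_k.
    * under eq_bigr => i _ do rewrite sumrB.
      by rewrite sumrB rmorphB /= upper_kE -pmulrn -u_k.
    * by rewrite big1 // => i _; rewrite big1.
- move=> q K; rewrite ffunE /= sum_layers !ffunE /=; set ij := row_pair q.
  rewrite /slim_entry /slim_jk; case: (colP K) => [i|j|k]; rewrite !col_caseE.
  + by case: eqP => _; rewrite ?layersE ?upper_ijE; ring.
  + by case: eqP => _; rewrite ?layersE ?upper_ijE; ring.
  + by rewrite !layersE upperE; ring.
Qed.

Lemma slim_array_ge0 x : @bounded_arrays R D x -> nonneg_array (slim_array p x).
Proof.
move=> xA l q K; have [X_ge0 X_le] := line_sum_bounds (row_pair q) xA.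
have [x_ge0 x_le _] := xA; rewrite ffunE /slim_entry /=.
case: (colP K) => [i|j|k]; rewrite !col_caseE.
- by case: eqP => // _; case: (layerP l); rewrite layersE ?subr_ge0.
- by case: eqP => // _; case: (layerP l); rewrite layersE ?subr_ge0.
- by case: (layerP l); rewrite layersE ?[p _]ffunE ?subr_ge0.
Qed.

Definition first_layer (y : real_array R 3 (r * c) (r + c + h)) : arrays :=
  [ffun q => y (l0, row_index q.1, col_k r c q.2)].

Lemma slim_arrayK x : first_layer (slim_array p x) = x.
Proof.
apply/ffunP => -[[i j] k]; rewrite !ffunE /= row_indexK /slim_entry.
by rewrite col_caseE.
Qed.

(** The 2-marginals determine all entries from the entries [x_ijk] in layer 0.
    Vanishing line sums kill layer 2 in the columns [k], layer 1 in the columns [i],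
    layer 0 in the columns [j], and all columns [i'], [j'] foreign to the row.
    Layer 1 of column [k] is then [p_ijk - x_ijk]; the row sums give layer 0 of
    column [i] and layer 1 of column [j]; the sums over the layers give layer 2 of
    these two columns. *)
Lemma first_layerK y : @arrays_with_2marginals R _ _ _ (slim D) y ->
  slim_array p (first_layer y) = y.
Proof.
move=> [y_ge0 [y_ij y_ik y_jk]].
pose x := first_layer y.
pose Y l ij K : R := y (l, row_index ij, K).
have Y_ge0 l ij K : 0 <= Y l ij K by apply: y_ge0.
have Yjk ij K : Y l0 ij K + Y l1 ij K + Y l2 ij K = (slim_jk ij K)%:~R.
  by have := y_jk (row_index ij) K; rewrite ffunE /= row_indexK sum_layers.
have Yij l ij : \sum_i Y l ij (col_i c h i) + \sum_j Y l ij (col_j r h j) +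
    \sum_k Y l ij (col_k r c k) = line_sum p ij.
  have := y_ij l (row_index ij).
  by rewrite ffunE /= row_indexK /slim_ij upper_ijE sum_cols.
have Yik l K : \sum_i \sum_j Y l (i, j) K = (slim_ik l K)%:~R.
  have := y_ik l K; rewrite ffunE /= => <-; rewrite -(sum_rows (fun ij => Y l ij K)).
  by apply: eq_bigr => q _; rewrite /Y row_pairK.
have Yik0 l K : slim_ik l K = 0 -> forall ij, Y l ij K = 0.
  move=> sum0 [i j]; apply: (sum_row_eq0 (F := fun i j => Y l (i, j) K)) => //.
  by rewrite Yik sum0.
have Y2k ij k : Y l2 ij (col_k r c k) = 0 by apply: Yik0; rewrite /slim_ik col_caseE.
have Y1i ij i : Y l1 ij (col_i c h i) = 0 by apply: Yik0; rewrite /slim_ik col_caseE.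
have Y0j ij j : Y l0 ij (col_j r h j) = 0 by apply: Yik0; rewrite /slim_ik col_caseE.
have Yjk0 ij K : slim_jk ij K = 0 -> forall l, Y l ij K = 0.
  move=> sum0 l; have := Yjk ij K; rewrite sum0 mulr0z.
  have := Y_ge0 l0 ij K; have := Y_ge0 l1 ij K; have := Y_ge0 l2 ij K.
  by case: (layerP l); lra.
have Yi l ij i : i != ij.1 -> Y l ij (col_i c h i) = 0.
  by move=> ne; apply: Yjk0; rewrite /slim_jk col_caseE (negPf ne).
have Yj l ij j : j != ij.2 -> Y l ij (col_j r h j) = 0.
  by move=> ne; apply: Yjk0; rewrite /slim_jk col_caseE (negPf ne).
have Yij' l ij : Y l ij (col_i c h ij.1) + Y l ij (col_j r h ij.2) +
    \sum_k Y l ij (col_k r c k) = line_sum p ij.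
  rewrite -(Yij l); congr (_ + _ + _).
    by rewrite (bigD1 ij.1) //= big1 ?addr0 // => i; apply: Yi.
  by rewrite (bigD1 ij.2) //= big1 ?addr0 // => j; apply: Yj.
have Y0k ij k : Y l0 ij (col_k r c k) = x (ij.1, ij.2, k).
  by rewrite /x ffunE /= -surjective_pairing.
have Y1k ij k : Y l1 ij (col_k r c k) =
    (p (ij.1, ij.2, k) : R) - (x (ij.1, ij.2, k) : R).
  have := Yjk ij (col_k r c k).
  by rewrite Y2k Y0k /slim_jk col_caseE upperE => <-; ring.
have X0 ij : \sum_k Y l0 ij (col_k r c k) = line_sum x ij.
  by apply: eq_bigr => k _; rewrite Y0k.
have X1 ij : \sum_k Y l1 ij (col_k r c k) = line_sum p ij - line_sum x ij.
  by rewrite -sumrB; apply: eq_bigr => k _; rewrite Y1k.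
have Y0i ij : Y l0 ij (col_i c h ij.1) = line_sum p ij - line_sum x ij.
  by rewrite -(Yij' l0 ij) Y0j X0; ring.
have Y1j ij : Y l1 ij (col_j r h ij.2) = line_sum x ij.
  by have := Yij' l1 ij; rewrite Y1i X1; lra.
have Y2i ij : Y l2 ij (col_i c h ij.1) = line_sum x ij.
  have := Yjk ij (col_i c h ij.1).
  by rewrite Y0i Y1i /slim_jk col_caseE eqxx upper_ijE; lra.
have Y2j ij : Y l2 ij (col_j r h ij.2) = line_sum p ij - line_sum x ij.
  have := Yjk ij (col_j r h ij.2).
  by rewrite Y0j Y1j /slim_jk col_caseE eqxx upper_ijE; lra.
apply/ffunP => -[[l q] K]; rewrite ffunE /= -/x -[q in RHS]row_pairK.
rewrite -[RHS]/(Y l (row_pair q) K); move: (row_pair q) => ij.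
rewrite /slim_entry; case: (colP K) => [i|j|k]; rewrite col_caseE.
- case: eqP => [->|/eqP ne]; last by rewrite Yi.
  by case: (layerP l); rewrite layersE.
- case: eqP => [->|/eqP ne]; last by rewrite Yj.
  by case: (layerP l); rewrite layersE.
- by case: (layerP l); rewrite layersE.
Qed.

(** The 1-marginals of [x] are sums over the rows in which the complementary terms
    do not occur: layer 2 of column [i], layer 1 of column [j], layer 0 of
    column [k]. *)
Lemma first_layer_bounded y : @arrays_with_2marginals R _ _ _ (slim D) y ->
  @bounded_arrays R D (first_layer y).
Proof.
move=> yB; have yE := first_layerK yB; have [y_ge0 [_ y_ik _]] := yB.
set x := first_layer y in yE *.
have entryE l ij K : (y (l, row_index ij, K) : R) = slim_entry p x l ij K.
  by rewrite -yE ffunE /= row_indexK.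
have Yik l K : \sum_i \sum_j slim_entry p x l (i, j) K = (slim_ik l K)%:~R.
  have := y_ik l K; rewrite ffunE /= => <-.
  rewrite -(sum_rows (fun ij => slim_entry p x l ij K)).
  by apply: eq_bigr => q _; rewrite -entryE row_pairK.
split.
- by move=> i j k; rewrite ffunE.
- move=> i j k; have := y_ge0 l1 (row_index (i, j)) (col_k r c k).
  by rewrite entryE /slim_entry col_caseE layersE [p _]ffunE subr_ge0.
split.
- move=> i; have := Yik l2 (col_i c h i).
  rewrite /slim_ik col_caseE layersE -pmulrn => <-.
  under [RHS]eq_bigr => i' _ do under eq_bigr => j _ do
    rewrite /slim_entry col_caseE layersE /=.
  rewrite [RHS]exchange_big /=; apply: eq_bigr => j _.
  by under [RHS] eq_bigr => i' _ do rewrite eq_sym; rewrite sum_diag.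
- move=> j; have := Yik l1 (col_j r h j).
  rewrite /slim_ik col_caseE layersE -pmulrn => <-.
  apply: eq_bigr => i _.
  rewrite -[LHS]/(line_sum x (i, j)) -(sum_diag j (fun j => line_sum x (i, j))).
  by apply: eq_bigr => j' _; rewrite /slim_entry col_caseE layersE eq_sym.
- move=> k; have := Yik l0 (col_k r c k).
  rewrite /slim_ik col_caseE layersE -pmulrn => <-.
  by apply: eq_bigr => i _; apply: eq_bigr => j _; rewrite /slim_entry col_caseE layersE.
Qed.

Lemma line_sum_int x ij :
  integer_array x -> line_sum x ij \is a Num.int.
Proof. by move=> x_int; apply: rpred_sum. Qed.

Lemma integer_slim_array x : integer_array x <-> integer_array (slim_array p x).
Proof.
split=> [x_int l q K | y_int i j k]; last by rewrite -(slim_arrayK x) ffunE.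
have p_int : integer_array p by move=> i j k; rewrite ffunE natr_int.
have X_int := line_sum_int (row_pair q) x_int.
have P_int := line_sum_int (row_pair q) p_int.
rewrite ffunE /slim_entry /=; case: (colP K) => [i|j|k]; rewrite col_caseE.
- by case: eqP => // _; case: (layerP l); rewrite layersE // rpredB.
- by case: eqP => // _; case: (layerP l); rewrite layersE // rpredB.
- by case: (layerP l); rewrite layersE // rpredB.
Qed.

(** Reading off layer 0 inverts the table, which proves injectivity and, with
    [first_layerK], surjectivity. *)
Lemma slim_array_bijective :
  integer_preserving_affine_bijective
    (@bounded_arrays R D) (@arrays_with_2marginals R _ _ _ (slim D)).
Proof.
exists (slim_array p); split; first exact: affine_slim_array.
  split.
  - move=> x xA; split; first exact: slim_array_ge0.
    by apply: slim_array_marginals; case: xA.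
  - by move=> x x' _ _ eq_y; rewrite -(slim_arrayK x) eq_y slim_arrayK.
  - move=> y yB; exists (first_layer y); first exact: first_layer_bounded.
    exact: first_layerK.
by move=> x _; apply: integer_slim_array.
Qed.

End Bijection.

Theorem theorem1p4 (R : realType) :
  exists v : forall D : bounded_data, slim_marginals D,
    polytime_computable encode_bounded_data
      (fun (D : bounded_data) (w : slim_marginals D) => encode_marginals2 w) v
    /\ (forall D : bounded_data,
          integer_preserving_affine_bijective
            (@bounded_arrays R D) (@arrays_with_2marginals R _ _ _ (v D))).
Proof.
exists slim; split; first exact: polytime_slim.
by move=> D; apply: slim_array_bijective.
Qed.
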